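(* If $G$ is a phi graph with a phi labeling $e_1<\dots<e_q$, then $G$ has an NBC basis with respect to this ordering.
   Context: Graphs are finite and may have loops and multiple edges. Phi graphs: take vertex-disjoint cycles $C^{(1)},\dots,C^{(t)}$ ($t\ge1$), each of length at least two, and in each $C^{(i)}$ two distinct distinguished edges $e^{(i)},f^{(i)}$ (for $i=t$ only $e^{(t)}$ is used). The phi graph is obtained by identifying the edge $f^{(i)}$ (with its endpoints) with the edge $e^{(i+1)}$ for $1\le i<t$. Let $p,q$ be its numbers of vertices and edges and $k=q-p+1$ (here $k=t$). A phi labeling names the edges $e_1,\dots,e_q$ as follows: the edge $e^{(i)}$ is named $e_{k-i+1}$ for $1\le i\le t$; then for $i=1,2,\dots,t$ in turn, $C^{(i)}-e^{(i)}-f^{(i)}$ (for $i=t$, $C^{(t)}-e^{(t)}$) is a disjoint union of at most two (possibly empty) paths $P,Q$; the edges of $P$, taken in order starting with the one adjacent to $e^{(i)}$, receive the largest still-unused names in decreasing order, and then the edges of $Q$ are treated the same way (so the first cycle's first path gets $e_q,e_{q-1},\dots$). The ordering $e_1<\dots<e_q$ is standard. Definitions: a total ordering $e_1<\dots<e_q$ of the edges of a graph with $p$ vertices is standard if the graph is connected and $e_{k+1},\dots,e_q$ form a spanning tree $T$. Work over $\mathbb{Z}_2$ with variable $x_i$ for $e_i$; $\mathbf{x}^S=\prod_{e_i\in S}x_i$. A circuit is the edge set of a cycle; its broken circuit is $\bar C=C\setminus\{\min C\}$. For $j>k$, $D_j$ is the set of edges with one endpoint in each component of $T-e_j$, and $\theta_j=\sum_{e_i\in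 D_j}x_i$. $I(G)$ is the ideal generated by all $\mathbf{x}^{\bar C}$ and $R(G)=\mathbb{Z}_2[x_1,\dots,x_q]/(I(G)+\langle\theta_j:j>k\rangle)$. For $1\le i\le k$, $C_i$ is the unique circuit of $T+e_i$ (fundamental circuits). Let $d_j=j$ for $j\le k$, $d_j=\min\{i:e_i\in D_j\}$ for $j>k$. Set $m_{\bar C}=x_i^{|\bar C_i|}$ if $C=C_i$, $i\le k$, and $m_{\bar C}=\prod_{e_j\in\bar C}x_{d_j}$ otherwise. $\mathrm{Mon}(k)$ is the set of monomials in $x_1,\dots,x_k$, $U(G)$ those divisible by some $m_{\bar C}$, $L(G)=\mathrm{Mon}(k)\setminus U(G)$. $G$ has an NBC basis with respect to the ordering if the images in $R(G)$ of the monomials of $L(G)$ are distinct and form a $\mathbb{Z}_2$-basis of $R(G)$. *)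

(* Defs.v *)
(* Finite multigraphs, broken circuits and the ring R(G), in MathComp with
   {mpoly 'F_2[q]} for the polynomial ring.  Excluded middle is used only to
   turn ideal membership into a boolean, as quotient types require. *)
From HB Require Import structures.
From mathcomp Require Import all_boot all_order all_fingroup all_algebra.
From mathcomp Require Import generic_quotient ring_quotient.
From mathcomp.multinomials Require Import mpoly.
From Stdlib Require Import ClassicalEpsilon.

Set Implicit Arguments.
Unset Strict Implicit.
Unset Printing Implicit Defensive.

Import GRing.Theory.
Local Open Scope ring_scope.
Local Open Scope quotient_scope.

(* -------------------------------------------------------------------- *)
(* The quotient of a commutative algebra by an ideal.  ring_quotient.v only
   covers proper ideals, whereas I(G) = (1) as soon as G has a loop; hence the
   quotient below is only a comPzRingType. *)

Record ideal (A : comNzRingType) := Ideal {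
  in_ideal :> A -> Prop;
  ideal0 : in_ideal 0;
  idealD : forall x y, in_ideal x -> in_ideal y -> in_ideal (x + y);
  idealM : forall a x, in_ideal x -> in_ideal (a * x)
}.

Section Ideals.
Variable A : comNzRingType.
Implicit Types (S : A -> Prop) (I J : ideal A).

Definition gen_by S (x : A) : Prop :=
  exists s : seq (A * A),
    (forall c, c \in s -> S c.2) /\ x = \sum_(c <- s) c.1 * c.2.

Lemma gen_by0 S : gen_by S 0.
Proof. by exists [::]; rewrite big_nil. Qed.

Lemma gen_byD S x y : gen_by S x -> gen_by S y -> gen_by S (x + y).
Proof.
move=> [s [hs ->]] [u [hu ->]]; exists (s ++ u); split; last by rewrite big_cat.
by move=> c; rewrite mem_cat => /orP[/hs | /hu].
Qed.

Lemma gen_byM S a x : gen_by S x -> gen_by S (a * x).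
Proof.
move=> [s [hs ->]]; exists [seq (a * c.1, c.2) | c <- s]; split.
  by move=> c /mapP[d ds ->]; exact: (hs d ds).
by rewrite big_map mulr_sumr; apply: eq_bigr => c _; rewrite mulrA.
Qed.

Definition ideal_gen S : ideal A :=
  Ideal (gen_by0 S) (@gen_byD S) (@gen_byM S).

Definition sum_of I J (x : A) : Prop :=
  exists a b, [/\ I a, J b & x = a + b].

Lemma sum_of0 I J : sum_of I J 0.
Proof. by exists 0, 0; split; rewrite ?addr0 //; apply: ideal0. Qed.

Lemma sum_ofD I J x y : sum_of I J x -> sum_of I J y -> sum_of I J (x + y).
Proof.
move=> [a [b [Ia Jb ->]]] [c [d [Ic Jd ->]]]; exists (a + c), (b + d).
by split; [apply: idealD | apply: idealD | rewrite addrACA].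
Qed.

Lemma sum_ofM I J a x : sum_of I J x -> sum_of I J (a * x).
Proof.
move=> [b [c [Ib Jc ->]]]; exists (a * b), (a * c).
by split; [apply: idealM | apply: idealM | rewrite mulrDr].
Qed.

Definition ideal_sum I J : ideal A :=
  Ideal (sum_of0 I J) (@sum_ofD I J) (@sum_ofM I J).

Definition idealb I : A -> bool :=
  fun x => if excluded_middle_informative (I x) then true else false.

Lemma idealbP I x : reflect (I x) (x \in idealb I).
Proof.
rewrite unfold_in /idealb.
by case: excluded_middle_informative => h; constructor.
Qed.

Lemma idealb_zmod_closed I : zmod_closed (idealb I).
Proof.
split=> [|x y /idealbP Ix /idealbP Iy]; apply/idealbP; first exact: ideal0.
by apply: idealD => //; rewrite -mulN1r; apply: idealM.
Qed.

HB.instance Definition _ I :=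
  GRing.isZmodClosed.Build A (idealb I) (idealb_zmod_closed I).

Definition idealq I := Quotient.quot (GRing.ZmodClosed.clone A (idealb I) _).

Section Quot.
Variable I : ideal A.
Local Notation Q := (idealq I).

HB.instance Definition _ := Choice.on Q.
HB.instance Definition _ := ZmodQuotient.on Q.

Lemma idealq_eqP (x y : A) : reflect (\pi_Q x = \pi_Q y) (x - y \in idealb I).
Proof. by rewrite Quotient.idealrBE; apply: eqP. Qed.

Definition idealq_one : Q := \pi_Q 1.
Definition idealq_mul : Q -> Q -> Q := lift_op2 Q *%R.

Lemma idealq_repr (x : A) : repr (\pi_Q x) - x \in idealb I.
Proof. by apply/idealq_eqP; rewrite reprK. Qed.

Lemma idealq_mulE (x y : A) : idealq_mul (\pi_Q x) (\pi_Q y) = \pi_Q (x * y).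
Proof.
unlock idealq_mul.
have /idealbP hx := idealq_repr x; have /idealbP hy := idealq_repr y.
apply/idealq_eqP/idealbP.
set a := repr (\pi_Q x) in hx *; set b := repr (\pi_Q y) in hy *.
have -> : a * b - x * y = b * (a - x) + x * (b - y).
  by rewrite !mulrBr [b * a]mulrC [b * x]mulrC addrA subrK.
by apply: idealD; apply: idealM.
Qed.

Lemma idealq_mulA : associative idealq_mul.
Proof.
by move=> x y z; rewrite -[x]reprK -[y]reprK -[z]reprK !idealq_mulE mulrA.
Qed.

Lemma idealq_mulC : commutative idealq_mul.
Proof. by move=> x y; rewrite -[x]reprK -[y]reprK !idealq_mulE mulrC. Qed.

Lemma idealq_mul1 : left_id idealq_one idealq_mul.
Proof. by move=> x; rewrite -[x]reprK /idealq_one idealq_mulE mul1r. Qed.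

Lemma idealq_mul1r : right_id idealq_one idealq_mul.
Proof. by move=> x; rewrite idealq_mulC idealq_mul1. Qed.

Lemma idealq_mulDl : left_distributive idealq_mul +%R.
Proof.
move=> x y z; rewrite -[x]reprK -[y]reprK -[z]reprK.
by rewrite -raddfD !idealq_mulE -raddfD mulrDl.
Qed.

Lemma idealq_mulDr : right_distributive idealq_mul +%R.
Proof. by move=> x y z; rewrite ![idealq_mul x _]idealq_mulC idealq_mulDl. Qed.

HB.instance Definition _ := GRing.Zmodule_isPzRing.Build Q
  idealq_mulA idealq_mul1 idealq_mul1r idealq_mulDl idealq_mulDr.
HB.instance Definition _ := GRing.PzRing_hasCommutativeMul.Build Q idealq_mulC.

Definition idealq_proj (x : A) : Q := \pi_Q x.

Lemma idealq_proj_zmod_morphism : zmod_morphism idealq_proj.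
Proof. by move=> x y; rewrite /idealq_proj raddfB. Qed.

Lemma idealq_proj_monoid_morphism : monoid_morphism idealq_proj.
Proof. by split=> // x y; rewrite /idealq_proj -idealq_mulE. Qed.

HB.instance Definition _ :=
  GRing.isZmodMorphism.Build A Q idealq_proj idealq_proj_zmod_morphism.
HB.instance Definition _ :=
  GRing.isMonoidMorphism.Build A Q idealq_proj idealq_proj_monoid_morphism.

Lemma idealq_proj_eq0 (x : A) : idealq_proj x = 0 <-> I x.
Proof.
rewrite -[0](raddf0 idealq_proj); split.
  by move/idealq_eqP/idealbP; rewrite subr0.
by move=> Ix; apply/idealq_eqP/idealbP; rewrite subr0.
Qed.

End Quot.
End Ideals.

Section IdealLmod.
Variables (F : comNzRingType) (A : comAlgType F) (I : ideal A).
Local Notation Q := (idealq I).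

Definition idealq_scale (a : F) : Q -> Q := lift_op1 Q ( *:%R a).

Lemma idealq_scaleE a (x : A) : idealq_scale a (\pi_Q x) = \pi_Q (a *: x).
Proof.
unlock idealq_scale; have /idealbP hx := idealq_repr I x.
apply/idealq_eqP/idealbP.
by rewrite -scalerBr -[_ - _]mul1r scalerAl; apply: idealM.
Qed.

Lemma idealq_scaleA a b (u : Q) :
  idealq_scale a (idealq_scale b u) = idealq_scale (a * b) u.
Proof. by rewrite -[u]reprK !idealq_scaleE scalerA. Qed.

Lemma idealq_scale1 : left_id 1 idealq_scale.
Proof. by move=> u; rewrite -[u]reprK idealq_scaleE scale1r. Qed.

Lemma idealq_scaleDr : right_distributive idealq_scale +%R.
Proof.
move=> a u v; rewrite -[u]reprK -[v]reprK.
by rewrite -raddfD !idealq_scaleE -raddfD scalerDr.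
Qed.

Lemma idealq_scaleDl (u : Q) : {morph idealq_scale^~ u : a b / a + b}.
Proof.
by move=> a b; rewrite -[u]reprK !idealq_scaleE -raddfD scalerDl.
Qed.

HB.instance Definition _ := GRing.Zmodule_isLmodule.Build F Q
  idealq_scaleA idealq_scale1 idealq_scaleDr idealq_scaleDl.

Lemma idealq_proj_scalable : scalable (@idealq_proj A I).
Proof. by move=> a x; rewrite /idealq_proj -idealq_scaleE. Qed.

HB.instance Definition _ := GRing.isScalable.Build F A Q *:%R
  (@idealq_proj A I) idealq_proj_scalable.

End IdealLmod.

Section Bases.
Variables (F : fieldType) (W : lmodType F).
Implicit Type B : W -> Prop.

Definition lin_indep B : Prop :=
  forall (s : seq W) (c : W -> F),
    uniq s -> (forall v, v \in s -> B v) ->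
    \sum_(v <- s) c v *: v = 0 -> forall v, v \in s -> c v = 0.

Definition spanning B : Prop :=
  forall w, exists (s : seq W) (c : W -> F),
    (forall v, v \in s -> B v) /\ w = \sum_(v <- s) c v *: v.

Definition is_basis B : Prop := lin_indep B /\ spanning B.

End Bases.

(* -------------------------------------------------------------------- *)
(* A multigraph is given by the pair of endpoints of each edge; the order
   within the pair is immaterial, and a loop has two equal endpoints. *)

Definition mgraph (V E : finType) := E -> V * V.

Section Multigraphs.
Variables (V E : finType) (G : mgraph V E).

Definition joins (f : E) (x y : V) : bool := (G f == (x, y)) || (G f == (y, x)).

Definition adj (A : {set E}) : rel V := fun x y => [exists f in A, joins f x y].

Definition connected_by (A : {set E}) : Prop :=
  (0 < #|V|)%N /\ forall x y, connect (adj A) x y.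

End Multigraphs.

(* For n = 1 this is a loop and for n = 2 a pair of parallel edges. *)
Definition cycle_graph (n : nat) : mgraph 'I_n 'I_n := fun j => (j, ordS j).

Definition circuit (V E : finType) (G : mgraph V E) (C : {set E}) : Prop :=
  exists (n : nat) (v : 'I_n -> V) (f : 'I_n -> E),
    [/\ (0 < n)%N, injective v, injective f,
        forall j, joins G (f j) (v (cycle_graph j).1) (v (cycle_graph j).2)
      & C = f @: [set: 'I_n]].

Definition spanning_tree (V E : finType) (G : mgraph V E) (A : {set E}) :
    Prop :=
  connected_by G A /\ forall C, circuit G C -> ~~ (C \subset A).

(* -------------------------------------------------------------------- *)
(* An edge-ordered graph e_1 < ... < e_q is a multigraph with edge type 'I_q:
   the ordinal i stands for e_(i+1), and 'X_i for the variable x_(i+1).  So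
   e_i with i <= k corresponds to ordinals i < k. *)

Section OrderedGraph.
Variables (V : finType) (q : nat) (G : mgraph V 'I_q).
Implicit Types (i j : 'I_q) (C : {set 'I_q}) (m : 'X_{1..q}).

(* q - p + 1, arranged so that the truncated subtraction is harmless when
   q = p - 1. *)
Definition nullity : nat := (q.+1 - #|V|)%N.
Local Notation k := nullity.

Definition tree_edges : {set 'I_q} := [set i : 'I_q | (k <= i)%N].
Local Notation T := tree_edges.

Definition standard : Prop :=
  connected_by G [set: 'I_q] /\ spanning_tree G T.

Definition broken C : {set 'I_q} :=
  C :\: [set i in C | [forall j in C, (i <= j)%N]].

(* For j in the spanning tree T, T - e_j has two components, so an edge has one
   endpoint in each iff its endpoints are not connected in T - e_j. *)
Definition cutset j : {set 'I_q} :=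
  [set i | ~~ connect (adj G (T :\ j)) (G i).1 (G i).2].

Definition theta j : {mpoly 'F_2[q]} := \sum_(i in cutset j) 'X_i.

Definition broken_circuit_ideal : ideal {mpoly 'F_2[q]} :=
  ideal_gen (fun x => exists2 C, circuit G C & x = \prod_(i in broken C) 'X_i).

Definition theta_ideal : ideal {mpoly 'F_2[q]} :=
  ideal_gen (fun x => exists2 j : 'I_q, (k <= j)%N & x = theta j).

Definition RG := idealq (ideal_sum broken_circuit_ideal theta_ideal).

Definition dmin j : 'I_q :=
  if (j < k)%N then j else [arg min_(i < j in cutset j) (i : nat)].

(* The monomial attached to a circuit C.  When the ordering is standard, a
   circuit contained in T + e_i is the fundamental circuit C_i. *)
Definition mbar C : 'X_{1..q} :=
  if [pick i : 'I_q | (i < k)%N && (C \subset i |: T)] is Some i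
  then (U_(i) *+ #|broken C|)%MM
  else (\sum_(j in broken C) U_(dmin j))%MM.

Definition Mon m : Prop := forall i : 'I_q, (k <= i)%N -> m i = 0%N.

Definition Umon m : Prop :=
  Mon m /\ exists2 C, circuit G C & (mbar C <= m)%MM.

Definition Lmon m : Prop := Mon m /\ ~ Umon m.

Definition RG_monomial m : RG := idealq_proj _ 'X_[m].

(* The notion is only meant for standard orderings, hence the first clause. *)
Definition has_NBC_basis : Prop :=
  [/\ standard,
      forall m m', Lmon m -> Lmon m' -> RG_monomial m = RG_monomial m' -> m = m'
    & is_basis (fun w : RG => exists2 m, Lmon m & w = RG_monomial m)].

End OrderedGraph.

(* -------------------------------------------------------------------- *)
(* Phi graphs.  The cycles C^(1), ..., C^(t) are indexed by 'I_t from 0, and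
   cycle i has length (len i).+2.  Coordinates on a cycle are chosen so that
   edge 0 is the distinguished edge e, and so that the walk 1, 2, ... from e to
   f runs along the path called P (traversing the cycle the other way exchanges
   P and Q).  [flip i] says which endpoint of f^(i) is identified with which
   endpoint of e^(i+1).  The values of fpos and flip at the last cycle are
   never used. *)

Record phi_data := PhiData {
  ncyc : nat;
  ncyc_gt0 : (0 < ncyc)%N;
  len : 'I_ncyc -> nat;
  fpos : forall i, 'I_(len i).+2;
  fpos_neq0 : forall i, fpos i != ord0;
  flip : 'I_ncyc -> bool
}.

Section PhiGraphs.
Variable D : phi_data.

(* Both the vertex set and the edge set of the disjoint union of the cycles. *)
Definition cycpt : finType := {i : 'I_(ncyc D) & 'I_(len i).+2}.

Definition pt (i : 'I_(ncyc D)) (j : 'I_(len i).+2) : cycpt :=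
  Tagged (fun i => 'I_(len i).+2) j.

Definition disjoint_cycles : mgraph cycpt cycpt := fun a =>
  (pt (cycle_graph (tagged a)).1, pt (cycle_graph (tagged a)).2).

Definition edge_e i : cycpt := pt (ord0 : 'I_(len i).+2).
Definition edge_f i : cycpt := pt (fpos i).

Definition glue_edge : rel cycpt := fun a b =>
  [exists i : 'I_(ncyc D), [exists i' : 'I_(ncyc D),
    [&& i' == i.+1 :> nat, a == edge_f i & b == edge_e i']]].

Definition glue_vertex : rel cycpt := fun x y =>
  [exists i : 'I_(ncyc D), [exists i' : 'I_(ncyc D), (i' == i.+1 :> nat) &&
    let: (u, v) := disjoint_cycles (edge_f i) in
    let: (w0, w1) := disjoint_cycles (edge_e i') in
    let: (w, z) := if flip i then (w1, w0) else (w0, w1) in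
    ((x == u) && (y == w)) || ((x == v) && (y == z))]].

Definition equiv_closure (X : finType) (r : rel X) : rel X :=
  connect (fun x y => r x y || r y x).

(* G is the quotient of the disjoint union of the cycles, via piV and piE. *)
Definition phi_graph (V E : finType) (G : mgraph V E)
    (piV : cycpt -> V) (piE : cycpt -> E) : Prop :=
  [/\ (forall x, exists a, piV a = x) /\ (forall f, exists a, piE a = f),
      forall a b, (piV a == piV b) = equiv_closure glue_vertex a b,
      forall a b, (piE a == piE b) = equiv_closure glue_edge a b
    & forall a, joins G (piE a) (piV (disjoint_cycles a).1)
                                (piV (disjoint_cycles a).2)].

(* The position of f in cycle i, or the length of the cycle for the last one,
   so that then P is the whole of C - e and Q is empty. *)
Definition stop (i : 'I_(ncyc D)) : nat :=
  if i.+1 == ncyc D then (len i).+2 else fpos i.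

Definition first_path (i : 'I_(ncyc D)) : seq cycpt :=
  [seq pt j | j : 'I_(len i).+2 <- enum 'I_(len i).+2 & (0 < j < stop i)%N].

Definition second_path (i : 'I_(ncyc D)) : seq cycpt :=
  rev [seq pt j | j : 'I_(len i).+2 <- enum 'I_(len i).+2 & (stop i < j)%N].

Definition path_edges : seq cycpt :=
  flatten [seq first_path i ++ second_path i | i <- enum 'I_(ncyc D)].

(* In 1-based terms: e^(i) is named e_(k-i+1), using up the names
   e_1, ..., e_k; the remaining edges, in the order of path_edges, are then
   named e_q, e_(q-1), ... *)
Definition phi_labeling (V : finType) (q : nat) (G : mgraph V 'I_q)
    (piE : cycpt -> 'I_q) : Prop :=
  (forall i : 'I_(ncyc D), (piE (edge_e i) + i.+1 = nullity V q)%N) /\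
  (forall (a0 : cycpt) (n : nat), (n < size path_edges)%N ->
     (piE (nth a0 path_edges n) + n.+1 = q)%N).

End PhiGraphs.

(* Main.v *)
(* The edges e^(1), ..., e^(k) that lie outside the tree cut the phi graph into
   levels.  A tree edge e_j of level a lies on the fundamental circuits of
   e^(1), ..., e^(a) only, so theta_j identifies x_j with y_1 + ... + y_a, where
   y_i is the variable of e^(i).  Circuits meet the cutsets D_j evenly, hence
   contain all or none of the tree edges of a level, and every broken circuit
   contains the broken circuit of one of the cycles C^(a).  So R(G) is the
   quotient of Z_2[y_1, ..., y_k] by y_a (y_1 + ... + y_a)^(n_a) for a < k and
   (y_1 + ... + y_k)^(n_k), where n_a counts the tree edges of level a.  Each of
   these is monic in y_a over the preceding variables, and L(G) is the
   corresponding box of exponents, so L(G) is a basis. *)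
From HB Require Import structures.
Require Import Defs.
From mathcomp Require Import all_boot all_order all_algebra zify.
From mathcomp.multinomials Require Import mpoly.

Set Implicit Arguments.
Unset Strict Implicit.
Unset Printing Implicit Defensive.

Import GRing.Theory Pdiv.Ring Pdiv.RingMonic.
Local Open Scope ring_scope.

(** * Triangular systems of monic polynomials *)

Section UnivariateView.
Variables (R : comNzRingType) (q : nat).
Implicit Types (c i : 'I_q) (f a : {mpoly R[q]}) (m : 'X_{1..q}).

(* The coefficients still live in the full ring {mpoly R[q]}: they merely do not
   involve 'X_c. *)
Definition as_poly c : {mpoly R[q]} -> {poly {mpoly R[q]}} :=
  mmap (polyC \o @mpolyC q R) (fun i => if i == c then 'X else ('X_i)%:P).

HB.instance Definition _ c := GRing.RMorphism.on (as_poly c).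

Lemma as_polyX c i : as_poly c 'X_i = if i == c then 'X else ('X_i)%:P.
Proof. by rewrite /as_poly mmapX mmap1U. Qed.

Lemma mpoly_rmorph_ind (S : comNzRingType) (u v : {rmorphism {mpoly R[q]} -> S}) :
  (forall x, u x%:MP = v x%:MP) -> (forall i, u 'X_i = v 'X_i) -> u =1 v.
Proof.
move=> uvC uvX p; rewrite [p]mpolyE !rmorph_sum; apply: eq_bigr => m _.
rewrite -mul_mpolyC !rmorphM uvC mpolyXE_id !rmorph_prod; congr (_ * _).
by apply: eq_bigr => i _; rewrite !rmorphXn uvX.
Qed.

Lemma as_polyK c f : (as_poly c f).['X_c] = f.
Proof.
rewrite -/(horner_eval 'X_c (as_poly c f)).
apply: (@mpoly_rmorph_ind _ (horner_eval 'X_c \o as_poly c) idfun) => [x|i] /=.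
  by rewrite /as_poly mmapC /= /horner_eval hornerC.
by rewrite as_polyX /horner_eval; case: eqP => [->|_]; rewrite ?hornerX ?hornerC.
Qed.

Lemma size_as_polyX c m : (size (as_poly c 'X_[m]) <= (m c).+1)%N.
Proof.
rewrite mpolyXE_id rmorph_prod (bigD1 c) //= rmorphXn /= as_polyX eqxx.
have [a ->] : exists a : {mpoly R[q]},
    \prod_(i < q | i != c) as_poly c ('X_i ^+ m i) = a%:P.
  exists (\prod_(i < q | i != c) 'X_i ^+ m i); rewrite rmorph_prod.
  by apply: eq_bigr => i nic; rewrite rmorphXn /= as_polyX (negPf nic) rmorphXn.
by rewrite mulrC mul_polyC (leq_trans (size_scale_leq _ _)) // size_polyXn.
Qed.

Lemma size_as_poly c f d :
  (forall m, m \in msupp f -> m c < d)%N -> (size (as_poly c f) <= d)%N.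
Proof.
move=> fd; rewrite [f]mpolyE rmorph_sum big_seq.
apply: (big_ind (fun p : {poly _} => size p <= d)%N).
- by rewrite size_poly0.
- by move=> x y hx hy; rewrite (leq_trans (size_polyD _ _)) // geq_max hx.
move=> m mf; rewrite -mul_mpolyC rmorphM /= {1}/as_poly mmapC /= mul_polyC.
by rewrite (leq_trans (size_scale_leq _ _)) // (leq_trans (size_as_polyX _ _)) ?fd.
Qed.

End UnivariateView.

Section Triangular.
Variables (R : comNzRingType) (q : nat) (g : 'I_q -> {mpoly R[q]}).
Implicit Types (c i : 'I_q) (f a : {mpoly R[q]}) (s : seq 'I_q).

(** For [g c] monic in ['X_c] the pseudo-remainder [rmodp] is a genuine remainder; evaluation at
    ['X_c] then returns to [{mpoly R[q]}]. *)
Definition prem c f : {mpoly R[q]} :=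
  (rmodp (as_poly c f) (as_poly c (g c))).['X_c].

Definition normal_form s f := foldl (fun f c => prem c f) f s.

(** The order of [s] matters: while dividing by one generator, all later generators are scalars. *)
Definition triangular s :=
  (forall c, c \in s -> as_poly c (g c) \is monic) /\
  pairwise (fun c i => as_poly c (g i) == (g i)%:P) s.

Lemma triangular_cons c s : triangular (c :: s) ->
  [/\ as_poly c (g c) \is monic,
      forall i, i \in s -> as_poly c (g i) = (g i)%:P & triangular s].
Proof.
case=> mon /= /andP[/allP gc pw]; split; first by rewrite mon ?mem_head.
  by move=> i /gc /eqP.
by split=> // i si; rewrite mon // inE si orbT.
Qed.

Lemma normal_formD s f a : triangular s ->
  normal_form s (f + a) = normal_form s f + normal_form s a.
Proof.
elim: s f a => // c s ih f a /triangular_cons[mon _ tri] /=.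
by rewrite -ih // /prem rmorphD /= rmodpD // hornerD.
Qed.

Lemma normal_form0 s : triangular s -> normal_form s 0 = 0.
Proof.
by move=> tri; apply: (addrI (normal_form s 0)); rewrite -normal_formD // !addr0.
Qed.

(** Divisions before the turn of [c] treat [g c] as a scalar and leave a multiple of it; the
    division by [g c] itself gives 0, which stays 0. *)
Lemma normal_form_mul s c a : triangular s -> c \in s ->
  normal_form s (a * g c) = 0.
Proof.
elim: s a => // i s ih a /triangular_cons[mon gi tri] /=; rewrite inE.
have [-> _|nci /= cs] := eqVneq c i.
  by rewrite /prem rmorphM /= rmodp_mull // horner0 normal_form0.
rewrite /prem rmorphM /= gi // mulrC mul_polyC rmodpZ // hornerZ mulrC.
exact: ih.
Qed.

Lemma normal_form_id s f :
  (forall c, c \in s -> size (as_poly c f) < size (as_poly c (g c)))%N ->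
  normal_form s f = f.
Proof.
elim: s => //= c s ih hs; rewrite /prem rmodp_small ?hs ?mem_head // as_polyK.
by apply: ih => i si; rewrite hs // inE si orbT.
Qed.

(** [normal_form] is additive, kills multiples of the generators and fixes reduced polynomials. *)
Lemma triangular_reduced_eq0 s f : triangular s ->
  gen_by (fun x => exists2 c, c \in s & x = g c) f ->
  (forall c, c \in s -> size (as_poly c f) < size (as_poly c (g c)))%N ->
  f = 0.
Proof.
move=> tri [r [hr ef]] small; rewrite -(normal_form_id small) {small}ef.
elim: r hr => [|x r ih] hr; first by rewrite big_nil normal_form0.
rewrite big_cons normal_formD // ih ?addr0; last first.
  by move=> y yr; apply: hr; rewrite inE yr orbT.
by have [c cs ->] := hr x (mem_head _ _); rewrite normal_form_mul.
Qed.

End Triangular.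

(** * Nested cuts *)

Lemma mpolyF2_addxx q (x : {mpoly 'F_2[q]}) : x + x = 0.
Proof. by rewrite -mulr2n -scaler_nat (_ : 2%:R = 0) ?scale0r //; apply/val_inj. Qed.

Lemma F2_neq0 (x : 'F_2) : x != 0 -> x = 1.
Proof. by move=> nx; apply/val_inj; case: x nx => [[|[|[]]]]. Qed.

(** A walk once round the circuit returns to its initial colour, so the colour changes an even
    number of times. *)
Lemma odd_card_colour (V E : finType) (G : mgraph V E) (chi : V -> bool)
    (D C : {set E}) :
  (forall i, chi (G i).1 (+) chi (G i).2 = (i \in D)) ->
  circuit G C -> ~~ odd #|C :&: D|.
Proof.
move=> chiD [n [v [f [n_gt0 _ f_inj fG ->]]]].
have -> : f @: [set: 'I_n] :&: D = f @: [set j | f j \in D].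
  apply/setP => i; apply/setIP/imsetP => [[/imsetP[j _ ->] fj]|[j]].
    by exists j; rewrite ?inE.
  by rewrite inE => fj ->; rewrite imset_f.
rewrite card_imset // -sum1_card.
have -> : odd (\sum_(j in [set j | f j \in D]) 1) =
    \big[addb/false]_j (chi (v j) (+) chi (v (ordS j))).
  rewrite (big_morph odd oddD (erefl _)) big_mkcond; apply: eq_bigr => j _.
  rewrite inE -chiD; case/orP: (fG j) => /eqP -> /=.
    by case: (_ (+) _).
  by rewrite addbC; case: (_ (+) _).
(* The rotation [ordS] permutes the vertices, so the two halves of the sum are equal and cancel. *)
rewrite big_split /= [X in _ (+) X](_ : _ = \big[addb/false]_j chi (v j)) ?addbb //.
by rewrite [RHS](reindex (@ordS n)) //; exact/onW_bij/ordS_bij.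
Qed.

Section NestedCuts.
Variables (V : finType) (q : nat) (G : mgraph V 'I_q) (lam : 'I_q -> 'I_q).
Local Notation k := (nullity V q).
Local Notation T := (tree_edges V q).
Implicit Types (i j c : 'I_q) (m : 'X_{1..q}) (f : {mpoly 'F_2[q]}).

(* In the phi graph [lam j] is the edge e^(a), where a is the level of e_j; since
   e^(a) is the ordinal k - a, the levels up to a are the ordinals
   [lam j <= i < k]. *)
Definition lead i : 'I_q := if (i < k)%N then i else lam i.

(* For c = 0 the truncated c.-1 is c itself: the last cycle has no edge f. *)
Definition face c : {set 'I_q} := [set i | (lead i == c) || (i == c.-1 :> nat)].

(** This is the interface between the graph and the algebra. [cut_colour] and [cut_bypass] determine
    every cutset from both sides; [level0] and [face_circuit] supply the tree edges of the innermost
    level and the cycles themselves. *)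
Record nested_cuts : Prop := NestedCuts {
  lam_lt : forall j, (k <= j)%N -> (lam j < k)%N;
  tree_connected : connected_by G T;
  cut_colour : forall j, (k <= j)%N -> exists chi : V -> bool, forall i,
    chi (G i).1 (+) chi (G i).2 = (i == j) || (lam j <= i < k)%N;
  cut_bypass : forall i j, (k <= j)%N -> (i < lam j)%N ->
    connect (adj G (T :\ j)) (G i).1 (G i).2;
  level0 : exists2 j : 'I_q, (k <= j)%N & lam j = 0%N :> nat;
  face_circuit : forall c, (c < k)%N -> circuit G (face c)
}.

Hypothesis hG : nested_cuts.

(** This is the broken circuit of [face c]. The minimum removed is [c.-1], which has another lead
    when [c > 0]; for [c = 0] it is the edge 0 itself, whence the condition [0 < i]. *)
Definition face_body c : {set 'I_q} := [set i | (lead i == c) && (0 < i)%N].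

Lemma k_gt0 : (0 < k)%N.
Proof. by have [j kj l0] := level0 hG; have := lam_lt hG kj; rewrite l0. Qed.

Lemma lead_lt i : (lead i < k)%N.
Proof. by rewrite /lead; case: (ltnP i k) => // /(lam_lt hG). Qed.

Lemma leadT j : (k <= j)%N -> lead j = lam j.
Proof. by rewrite /lead ltnNge => ->. Qed.

Lemma lead_id c : (c < k)%N -> lead c = c.
Proof. by rewrite /lead => ->. Qed.

Lemma face_body_ge c i : i \in face_body c -> (c <= i)%N.
Proof.
rewrite inE => /andP[/eqP <- _]; rewrite /lead; case: (ltnP i k) => // ki.
exact: ltnW (leq_trans (lam_lt hG ki) ki).
Qed.

(** Edges of [T :\ j] preserve [chi], so an edge changing colour cannot be bypassed there. An edge
    keeping its colour either lies in [T :\ j] or is below [lam j], where [cut_bypass] applies. *)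
Lemma cutsetE j : (k <= j)%N -> cutset G j = j |: [set i : 'I_q | lam j <= i < k]%N.
Proof.
move=> kj; have [chi chiE] := cut_colour hG kj; apply/setP => i; rewrite !inE.
rewrite -chiE; apply/idP/idP => [|cross].
  apply: contraNT; rewrite chiE negb_or => /andP[nij nli].
  have [li|li] := ltnP i (lam j); first exact: (cut_bypass hG kj).
  rewrite li /= -leqNgt in nli; apply: connect1; apply/existsP; exists i.
  by rewrite !inE nij nli /= /joins -surjective_pairing eqxx.
apply/negP => con.
suff H x y : adj G (T :\ j) x y -> chi x = chi y.
  have cl : closed (adj G (T :\ j)) [pred x | chi x == chi (G i).1].
    by move=> x y /H; rewrite !inE => ->.
  have := closed_connect cl con; rewrite !inE eqxx => /esym/eqP e.
  by rewrite e addbb in cross.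
case/existsP => l; rewrite !inE => /andP[/andP[nlj kl]] G_l.
have := chiE l; rewrite (negPf nlj) /= ltnNge kl andbF => /eqP.
by case/orP: G_l => /eqP -> /=; case: (chi x); case: (chi y).
Qed.

Lemma dmin_lead j : dmin G j = lead j.
Proof.
rewrite /dmin /lead; case: ltnP => // kj.
have jD : j \in cutset G j by rewrite cutsetE // setU11.
case: arg_minnP => // i iD min.
have lD : lam j \in cutset G j by rewrite cutsetE // !inE leqnn (lam_lt hG) ?orbT.
apply/val_inj/eqP; rewrite eqn_leq (min _ lD) /=.
move: iD; rewrite cutsetE // !inE => /orP[/eqP ->|/andP[]//].
exact: ltnW (leq_trans (lam_lt hG kj) kj).
Qed.

(** * Circuits and their broken circuits *)

Lemma circuit_nonempty C : circuit G C -> exists i, i \in C.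
Proof.
move=> [n [v [f [n_gt0 _ _ _ ->]]]]; exists (f (Ordinal n_gt0)).
exact: imset_f.
Qed.

Lemma circuit_even C j : circuit G C -> (k <= j)%N ->
  ~~ odd #|C :&: (j |: [set i : 'I_q | lam j <= i < k]%N)|.
Proof.
move=> cC kj; have [chi chiE] := cut_colour hG kj.
by apply: (odd_card_colour _ cC) => i; rewrite !inE; apply: chiE.
Qed.

(** In a circuit inside the tree, any edge [j] would be the only edge in its own cutset, against
    parity. *)
Lemma circuit_max C : circuit G C ->
  exists c, [/\ (c < k)%N, c \in C & forall i, i \in C -> (i < k)%N -> (i <= c)%N].
Proof.
move=> cC; have [/exists_inP[i0 i0C ki0]|/exists_inPn none] :=
  boolP [exists i in C, (i < k)%N].
  case: (@arg_maxnP _ i0 [pred i | (i \in C) && (i < k)%N] (fun i => i)) => /=.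
    by rewrite i0C.
  by move=> c /andP[cC' ck] cmax; exists c; split=> // i iC ik; apply: cmax; rewrite /= iC.
have [j jC] := circuit_nonempty cC.
have := none j jC; rewrite -leqNgt => kj; have := circuit_even cC kj.
rewrite (_ : _ :&: _ = [set j]) ?cards1 //; apply/setP => i; rewrite !inE.
have [->|_] := eqVneq i j; first by rewrite jC.
by apply/negP => /andP[iC /andP[_ ik]]; move: (none i iC); rewrite ik.
Qed.

Lemma spanning_treeT : spanning_tree G T.
Proof.
split; first exact: tree_connected hG.
move=> C /circuit_max[c [ck cC _]]; apply/subsetPn; exists c => //.
by rewrite inE -ltnNge.
Qed.

Lemma standardG : standard G.
Proof.
split; last exact: spanning_treeT.
have [V0 con] := tree_connected hG; split=> // x y.
apply: connect_sub (con x y) => u v /existsP[i /andP[_ uv]].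
by apply: connect1; apply/existsP; exists i; rewrite inE.
Qed.

(** Let [c] be the largest non-tree edge of [C]. If [C] has an edge below [c], then it is not
    fundamental and its minimum lies below all of [face_body c]. Otherwise [c] is its only non-tree
    edge and [C] is fundamental. *)
Lemma circuit_cases C : circuit G C ->
  (exists c, [/\ (c < k)%N, face_body c \subset broken C
     & mbar G C = (\sum_(j in broken C) U_(lead j))%MM]) \/
  (exists c, [/\ (c < k)%N, c \in C, mbar G C = (U_(c) *+ #|broken C|)%MM
     & broken C = [set j : 'I_q | (k <= j) && (lam j <= c)]%N]).
Proof.
move=> cC; have [c [ck c_C cmax]] := circuit_max cC.
have gC : face_body c \subset C.
  apply/subsetP => j; rewrite inE => /andP[/eqP lj _].
  have [jk|kj] := ltnP j k; first by rewrite -(lead_id jk) lj.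
  (* If [j] were missing, the maximality of [c] would leave [c] as the only edge of [C] in the
     cutset of [j]. *)
  have := circuit_even cC kj; apply: contraNT => jC.
  rewrite (_ : _ :&: _ = [set c]) ?cards1 //; apply/setP => i.
  rewrite -leadT // lj !inE.
  have [->|nij] := eqVneq i j.
    by rewrite (negPf jC) /=; apply/esym/eqP => jc; rewrite jc c_C in jC.
  have [->|nic] := eqVneq i c; first by rewrite c_C leqnn.
  rewrite /=; apply/negP => /and3P[iC ci ik].
  by case/eqP: nic; apply/val_inj/eqP; rewrite eqn_leq ci cmax.
have [/exists_inP[i iC ic]|/exists_inPn none] := boolP [exists i in C, (i < c)%N].
  left; exists c; split=> //.
    apply/subsetP => j jg; rewrite !inE (subsetP gC) //= andbT.
    apply/forall_inPn; exists i => //; rewrite -ltnNge.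
    exact: leq_trans ic (face_body_ge jg).
  rewrite /mbar; case: pickP => [l /andP[lk /subsetP CT]|_]; last first.
    by apply: eq_bigr => j _; rewrite dmin_lead.
  have := CT _ iC; have := CT _ c_C; rewrite !inE.
  rewrite leqNgt ck orbF leqNgt (ltn_trans ic ck) orbF => /eqP cl /eqP il.
  by rewrite il cl ltnn in ic.
have onlyc i : i \in C -> (i < k)%N -> i = c.
  move=> iC ik; apply/val_inj/eqP; rewrite eqn_leq cmax //= leqNgt.
  exact: none.
(* With a single non-tree edge, parity puts a tree edge [j] in [C] exactly when [c] lies in the
   cutset of [j]. *)
have bE : broken C = [set j : 'I_q | (k <= j) && (lam j <= c)]%N.
  apply/setP => j; rewrite !inE; have [jk|kj] := ltnP j k.
    apply/negP => /andP[+ jC]; rewrite jC (onlyc _ jC jk) /= => /forall_inPn[i iC].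
    by rewrite -ltnNge (negPf (none _ iC)).
  have -> : (j \in C) && [forall i in C, (j <= i)%N] = false.
    apply/negP => /andP[jC /forall_inP/(_ _ c_C)] jc.
    by move: (leq_trans ck kj); rewrite ltnNge jc.
  rewrite /=; have := circuit_even cC kj.
  have nc : c != j by apply: contraTneq ck => ->; rewrite -leqNgt.
  have [lc|lc] := leqP (lam j) c.
    apply: contraNT => jC.
    rewrite (_ : _ :&: _ = [set c]) ?cards1 //; apply/setP => i; rewrite !inE.
    have [->|nic] := eqVneq i c; first by rewrite c_C lc ck orbT.
    apply/negP => /andP[iC /orP[/eqP ij|/andP[_ ik]]]; first by rewrite -ij iC in jC.
    by rewrite (onlyc i) ?eqxx in nic.
  apply: contraNF => jC.
  rewrite (_ : _ :&: _ = [set j]) ?cards1 //; apply/setP => i; rewrite !inE.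
  have [->|nij] := eqVneq i j; first by rewrite jC.
  by apply/negP => /and3P[iC li ik]; rewrite (onlyc i) // leqNgt lc in li.
right; exists c; split=> //; rewrite /mbar.
case: pickP => [l /andP[lk /subsetP CT]|/(_ c)].
  by have := CT _ c_C; rewrite !inE leqNgt ck orbF => /eqP ->.
case/negP; rewrite ck; apply/subsetP => i iC; rewrite !inE.
by have [ik|_] := ltnP i k; rewrite ?orbT // (onlyc i) ?eqxx.
Qed.

Lemma broken_face c : (c < k)%N -> broken (face c) = face_body c.
Proof.
move=> ck; have c1q : (c.-1 < q)%N by rewrite (leq_ltn_trans (leq_pred _)).
(* An edge [c.-1] is outside the tree, hence its own lead; it has lead [c] only when [c = 0]. *)
have lead_pred i : lead i = c -> (i == c.-1 :> nat) = (i == 0%N :> nat).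
  move=> lic; apply/eqP/eqP => [ic|i0].
    by move: lic; rewrite lead_id => [/(congr1 val) /=|]; lia.
  by move: lic; rewrite lead_id ?i0 ?k_gt0 // => <-; rewrite i0.
have min i : i \in face c -> (c.-1 <= i)%N.
  rewrite inE => /orP[/eqP lic|/eqP -> //].
  have [/eqP i0|i0] := posnP i; first by rewrite -lead_pred // in i0; rewrite (eqP i0).
  have /face_body_ge : i \in face_body c by rewrite inE lic eqxx.
  exact: leq_trans (leq_pred _).
have p_face : Ordinal c1q \in face c by rewrite inE /= eqxx orbT.
apply/setP => i; rewrite in_setD [in X in ~~ X]inE.
have [iF|iF] := boolP (i \in face c); rewrite ?andbF ?andbT /=; last first.
  by apply/esym/negP; rewrite inE => /andP[lic _]; move: iF; rewrite inE lic.
have -> : [forall j in face c, (i <= j)%N] = (i == c.-1 :> nat).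
  apply/forall_inP/eqP => [H|-> //]; apply/eqP; rewrite eqn_leq min // andbT.
  exact: (H _ p_face).
move: iF; rewrite !inE; have [lic _|_ /= -> //] := eqVneq (lead i) c.
by rewrite lead_pred // lt0n.
Qed.

Definition RG_ideal : ideal {mpoly 'F_2[q]} :=
  ideal_sum (broken_circuit_ideal G) (theta_ideal G).

Lemma face_body_subset_broken C : circuit G C ->
  exists2 c : 'I_q, (c < k)%N & face_body c \subset broken C.
Proof.
move=> cC; have [[c [ck gc _]]|[c [ck _ _ ->]]] := circuit_cases cC.
  by exists c.
(* A fundamental circuit contains all tree edges of lead 0, and these form the face body of 0. *)
have [j kj lj] := level0 hG; exists (lam j); first exact: (lam_lt hG).
apply/subsetP => i; rewrite !inE; have [ik|ki] := ltnP i k.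
  by rewrite lead_id // -val_eqE /= lj lt0n andbN.
by rewrite leadT // => /andP[/eqP -> _]; rewrite lj.
Qed.

Lemma face_body_lead (F : {set 'I_q}) c : F \subset face_body c ->
  (\sum_(j in F) U_(lead j))%MM = (U_(c) *+ #|F|)%MM.
Proof.
move=> /subsetP Fc; apply/mnmP => i; rewrite mnm_sumE mulmnE.
rewrite (eq_bigr (fun _ => U_(c)%MM i)) ?sum_nat_const 1?mulnC // => j /Fc.
by rewrite inE => /andP[/eqP ->].
Qed.

Lemma mbar_face c : (c < k)%N -> mbar G (face c) = (U_(c) *+ #|face_body c|)%MM.
Proof.
move=> ck; have [[d [_ _ ->]]|[d [dk dF -> bE]]] := circuit_cases (face_circuit hG ck).
  by rewrite broken_face // (face_body_lead (subxx (face_body c))).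
rewrite broken_face // in bE *; suff -> : d = c by [].
move: dF; rewrite inE lead_id // => /orP[/eqP //|/eqP dc].
have [c0|c0] := posnP c; first by apply/val_inj; rewrite /= dc c0.
(* If [d = c.-1] with [c > 0], the non-tree edge [c] would lie in a broken circuit made of tree
   edges. *)
have : c \in face_body c by rewrite inE lead_id // eqxx c0.
by rewrite bE inE leqNgt ck.
Qed.

(** The monomial of any circuit is thus divisible by that of a face, so the faces alone bound
    [Lmon]. *)
Lemma mbar_ge C : circuit G C ->
  exists2 c : 'I_q, (c < k)%N & (#|face_body c| <= mbar G C c)%N.
Proof.
move=> cC; have [[c [ck gb ->]]|[c [ck _ -> bE]]] := circuit_cases cC; exists c => //.
  rewrite mnm_sumE (big_setID (face_body c)) /= (setIidPr gb) -mnm_sumE.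
  rewrite (face_body_lead (subxx (face_body c))).
  by rewrite mulmnE mnm1E eqxx mul1n leq_addr.
rewrite mulmnE mnm1E eqxx mul1n bE; have [j kj lj] := level0 hG.
have [c0|c0] := posnP c.
  apply: subset_leq_card; apply/subsetP => i; rewrite !inE => /andP[lic i0].
  have [ik|ki] := ltnP i k; last by rewrite -leadT // (eqP lic) leqnn.
  by move: lic; rewrite lead_id // -val_eqE /= c0; move: i0; rewrite lt0n => /negPf ->.
(* For [c > 0] the body contains [c], which is absent from [broken C]; in the count the tree edge
   [j] of lead 0 takes its place. *)
rewrite (cardsD1 c) inE lead_id // eqxx c0.
have nj : j \notin face_body c :\ c.
  rewrite !inE leadT // -[lam j == c]val_eqE /= lj; case: (c : nat) c0 => //= n _.
  by rewrite andbF.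
apply: leq_trans (_ : #|j |: face_body c :\ c| <= _)%N; first by rewrite cardsU1 nj.
apply: subset_leq_card; apply/subsetP => i; rewrite !inE.
move=> /orP[/eqP ->|/and3P[nic lic i0]]; first by rewrite kj lj.
have [ik|ki] := ltnP i k; last by rewrite -leadT // (eqP lic) leqnn.
by rewrite -(eqP lic) lead_id // eqxx in nic.
Qed.

Lemma LmonE m : Lmon G m <->
  Mon V m /\ forall c, (c < k)%N -> (m c < #|face_body c|)%N.
Proof.
split=> [[Mm nU]|[Mm box]]; split=> //.
  move=> c ck; rewrite ltnNge; apply/negP => cm; apply: nU; split=> //.
  exists (face c); first exact: (face_circuit hG).
  rewrite mbar_face //; apply/mnm_lepP => i; rewrite mulmnE mnm1E.
  by have [<-|_] := eqVneq c i; rewrite ?mul1n ?mul0n.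
case=> _ [C cC /mnm_lepP mC]; have [c ck hc] := mbar_ge cC.
by move: (box c ck); rewrite ltnNge (leq_trans hc).
Qed.

(** * Elimination of the tree variables and independence *)

Section Elimination.
Variable R : comNzRingType.

Definition tail_sum i : {mpoly R[q]} := \sum_(l : 'I_q | (lead i < l < k)%N) 'X_l.

(** Over ['F_2], the relation [theta G i = 0] of a tree edge reads ['X_i = subst_var i]. *)
Definition subst_var i : {mpoly R[q]} :=
  if (i < k)%N then 'X_i else 'X_(lam i) + tail_sum i.

Definition subst_free : {mpoly R[q]} -> {mpoly R[q]} := mmap (@mpolyC q R) subst_var.

HB.instance Definition _ := GRing.RMorphism.on subst_free.

Lemma subst_freeX i : subst_free 'X_i = subst_var i.
Proof. by rewrite /subst_free mmapX mmap1U. Qed.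

Definition face_gen c : {mpoly R[q]} := \prod_(i in face_body c) subst_var i.

Definition free_vars : seq 'I_q := [seq c : 'I_q <- enum 'I_q | (c < k)%N].

Lemma mem_free_vars c : (c \in free_vars) = (c < k)%N.
Proof. by rewrite mem_filter mem_enum andbT. Qed.

Lemma subst_free_id (f : {mpoly R[q]}) :
  (forall m, m \in msupp f -> Mon V m) -> subst_free f = f.
Proof.
move=> fM; rewrite {1 2}[f]mpolyE rmorph_sum !big_seq; apply: eq_bigr => m /fM Mm.
rewrite /= -mul_mpolyC rmorphM /= {1}/subst_free mmapC; congr (_ * _).
rewrite mpolyXE_id rmorph_prod; apply: eq_bigr => i _; rewrite rmorphXn /= subst_freeX.
by rewrite /subst_var; case: ltnP => // /Mm ->; rewrite !expr0.
Qed.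

(** Each factor is ['X_c] plus a sum of variables above [c], so the product is monic in ['X_c] of
    degree [#|face_body c|]. *)
Lemma as_poly_gen c : (c < k)%N ->
  exists a : 'I_q -> {mpoly R[q]},
    as_poly c (face_gen c) = \prod_(i <- enum (face_body c)) ('X - (a i)%:P).
Proof.
move=> ck; exists (fun i => if (i < k)%N then 0 else - tail_sum i).
rewrite /face_gen -big_enum rmorph_prod !big_seq; apply: eq_bigr => i /=.
rewrite mem_enum inE => /andP[/eqP lic _]; rewrite /subst_var.
case: (ltnP i k) => ik.
  by rewrite (as_polyX R) subr0 -lic lead_id // eqxx.
rewrite rmorphD /= (as_polyX R) -leadT // lic eqxx polyCN opprK; congr (_ + _).
rewrite /tail_sum !rmorph_sum; apply: eq_bigr => l; rewrite lic => /andP[cl _].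
by rewrite /= (as_polyX R); case: eqP => // lc; rewrite lc ltnn in cl.
Qed.

Lemma as_poly_gen_const c i : (c < i)%N -> as_poly c (face_gen i) = (face_gen i)%:P.
Proof.
move=> ci; rewrite /face_gen !rmorph_prod; apply: eq_bigr => j.
have X (l : 'I_q) : (c < l)%N -> as_poly c 'X_l = ('X_l : {mpoly R[q]})%:P.
  by move=> cl; rewrite (as_polyX R); case: eqP => // lc; rewrite lc ltnn in cl.
rewrite inE => /andP[/eqP lji _]; rewrite /subst_var; case: (ltnP j k) => jk.
  by rewrite /= X // -(lead_id jk) lji.
rewrite !rmorphD /= X; last by rewrite -leadT // lji.
congr (_ + _); rewrite !rmorph_sum; apply: eq_bigr => l /andP[il _].
by apply: X; apply: leq_trans il; rewrite lji ltnW.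
Qed.

(** Only variables of index at least [i] occur in [face_gen i], so the increasing enumeration has
    the required order. *)
Lemma triangular_gen : triangular face_gen free_vars.
Proof.
split=> [c|].
  by rewrite mem_free_vars => ck; have [a ->] := as_poly_gen ck; exact: monic_prod_XsubC.
apply: (@sub_pairwise _ (relpre val ltn)) => [c i ci|].
  by apply/eqP/as_poly_gen_const.
apply: (subseq_pairwise (filter_subseq _ (enum 'I_q))).
by rewrite -pairwise_map val_enum_ord -sorted_pairwise ?iota_ltn_sorted //; exact: ltn_trans.
Qed.

Lemma gen_reduced_eq0 (f : {mpoly R[q]}) :
  gen_by (fun x => exists2 c, c \in free_vars & x = face_gen c) f ->
  (forall m, m \in msupp f -> forall c, (c < k)%N -> (m c < #|face_body c|)%N) ->
  f = 0.
Proof.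
move=> Jf box; apply: (triangular_reduced_eq0 triangular_gen Jf) => c.
rewrite mem_free_vars => ck; have [a ->] := as_poly_gen ck.
rewrite size_prod_XsubC ltnS -cardE; apply: size_as_poly => m mf.
exact: box.
Qed.

End Elimination.

Lemma thetaE j : (k <= j)%N -> theta G j = 'X_j + subst_var 'F_2 j.
Proof.
move=> kj; rewrite /theta cutsetE // big_setU1 ?inE /=; last first.
  by rewrite ltnNge kj andbF.
rewrite /subst_var ltnNge kj /=; congr (_ + _).
rewrite (bigD1 (lam j)) /=; last by rewrite inE leqnn (lam_lt hG).
congr (_ + _); apply: eq_bigl => i; rewrite inE leadT // -[i == _]val_eqE /=; lia.
Qed.

(** The substitution kills each [theta] by characteristic two. A broken circuit contains a whole
    face body, so its monomial becomes a multiple of some [face_gen]. *)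
Lemma subst_free_gen f : RG_ideal f ->
  ideal_gen (fun x => exists2 c, c \in free_vars & x = face_gen 'F_2 c) (subst_free f).
Proof.
set J := ideal_gen _; have kill (S : {mpoly 'F_2[q]} -> Prop) x :
    (forall y, S y -> J (subst_free y)) -> gen_by S x -> J (subst_free (x : {mpoly 'F_2[q]})).
  move=> HS [s [hs ->]]; rewrite rmorph_sum big_seq.
  apply: (big_ind (fun y => J y)) => [||y ys]; [exact: ideal0|exact: idealD|].
  by rewrite rmorphM; apply: (@idealM _ J); apply: HS; apply: hs.
case=> a [b [Ia Jb ->]]; rewrite rmorphD; apply: idealD.
  apply: kill Ia => y [C cC ->]; have [c ck sub] := face_body_subset_broken cC.
  rewrite (big_setID (face_body c)) /= (setIidPr sub) mulrC rmorphM; apply: (@idealM _ J).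
  exists [:: (1, face_gen 'F_2 c)]; split.
    by move=> d; rewrite inE => /eqP -> /=; exists c; rewrite ?mem_free_vars.
  rewrite big_seq1 mul1r rmorph_prod; apply: eq_bigr => i _; exact: subst_freeX.
apply: kill Jb => y [j kj ->]; rewrite thetaE // rmorphD /= subst_freeX.
suff -> : subst_free (subst_var 'F_2 j) = subst_var 'F_2 j.
  by rewrite mpolyF2_addxx; exact: (ideal0 J).
have X (l : 'I_q) : (l < k)%N -> subst_free 'X_l = 'X_l by rewrite subst_freeX /subst_var => ->.
rewrite /subst_var ltnNge kj /= rmorphD /= X ?(lam_lt hG) //; congr (_ + _).
by rewrite rmorph_sum; apply: eq_bigr => l /andP[_ lk]; exact: X.
Qed.

(** A polynomial supported on [Lmon] has no tree variables, so the substitution fixes it, and it is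
    reduced for the triangular system. *)
Lemma reduced_eq0 f : RG_ideal f -> (forall m, m \in msupp f -> Lmon G m) -> f = 0.
Proof.
move=> /subst_free_gen; set J := ideal_gen _ => Jf fL.
rewrite subst_free_id in Jf; last by move=> m /fL[].
apply: gen_reduced_eq0 Jf _ => m /fL /LmonE[_]; apply.
Qed.

(** * Spanning by rewriting modulo the ideal *)

Local Notation K := RG_ideal.

(* Modulo the ideal, 'X_i is 'X_(lead i) plus variables 'X_l with lead i < l < k,
   which are lighter; this makes the rewriting of 'X_c ^+ #|face_body c|
   terminate. *)
Definition weight m : nat := (\sum_i m i * (k - i))%N.

Lemma weightD m1 m2 : weight (m1 + m2)%MM = (weight m1 + weight m2)%N.
Proof. by rewrite /weight -big_split; apply: eq_bigr => i _; rewrite mnmDE mulnDl. Qed.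

Lemma weightU c n : weight (U_(c) *+ n)%MM = (n * (k - c))%N.
Proof.
rewrite /weight (bigD1 c) //= mulmnE mnm1E eqxx mul1n big1 ?addn0 // => i nic.
by rewrite mulmnE mnm1E eq_sym (negPf nic).
Qed.

(** As the bound is strict, [light 0 f] means that [f] lies in the ideal; this is the base of the
    induction on [w]. *)
Definition light w f : Prop :=
  exists f', K (f - f') /\
    forall m, m \in msupp f' -> Mon V m /\ (weight m < w)%N.

Lemma light_ideal w f : K f -> light w f.
Proof. by move=> Kf; exists 0; rewrite subr0; split=> // m; rewrite msupp0. Qed.

Lemma light_leq w v f : (w <= v)%N -> light w f -> light v f.
Proof.
by move=> wv [f' [Kf fw]]; exists f'; split=> // m /fw[Mm mw]; rewrite (leq_trans mw).
Qed.

Lemma lightD w f g : light w f -> light w g -> light w (f + g).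
Proof.
move=> [f' [Kf fw]] [g' [Kg gw]]; exists (f' + g'); split.
  by rewrite opprD addrACA; apply: (@idealD _ K).
by move=> m /msuppD_le; rewrite mem_cat => /orP[/fw|/gw].
Qed.

(** One strict and one weak weight bound add up to a strict one; [v.+1] expresses the weak bound. *)
Lemma lightM w v f g : light w f -> light v.+1 g -> light (w + v) (f * g).
Proof.
move=> [f' [Kf fw]] [g' [Kg gv]]; exists (f' * g'); split.
  have -> : f * g - f' * g' = g * (f - f') + f' * (g - g').
    by rewrite !mulrBr ![g * _]mulrC addrA subrK.
  by apply: (@idealD _ K); apply: (@idealM _ K).
move=> m /msuppM_le /allpairsP[[m1 m2] /= [/fw[M1 w1] /gv[M2 w2] ->]].
split=> [i ki|]; first by rewrite mnmDE M1 // M2.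
by rewrite weightD; lia.
Qed.

Lemma light_mon m w : Mon V m -> (weight m < w)%N -> light w 'X_[m].
Proof.
move=> Mm mw; exists 'X_[m]; rewrite subrr; split; first exact: (ideal0 K).
by move=> m'; rewrite msuppX inE => /eqP ->.
Qed.

Lemma light_freeX c w : (c < k)%N -> (k - c < w)%N -> light w 'X_c.
Proof.
move=> ck cw; apply: light_mon; last by have := weightU c 1; rewrite mul1n => ->.
by move=> i ki; rewrite mnm1E; case: eqP => // ci; rewrite -ci leqNgt ck in ki.
Qed.

Lemma light_diff i : light (k - lead i) ('X_i - 'X_(lead i)).
Proof.
have [ik|ki] := ltnP i k.
  by rewrite lead_id // subrr; apply: light_ideal; apply: (ideal0 K).
have tail : light (k - lead i) (tail_sum 'F_2 i).
  apply: big_ind => [||l /andP[il lk]]; [|exact: lightD|].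
    by apply: light_ideal; apply: (ideal0 K).
  by apply: light_freeX => //; lia.
have -> : 'X_i - 'X_(lead i) = theta G i + tail_sum 'F_2 i.
  rewrite thetaE // /subst_var ltnNge ki -leadT //= -!addrA mpolyF2_addxx addr0.
  by congr (_ + _); apply/eqP; rewrite eq_sym -addr_eq0 mpolyF2_addxx.
apply: lightD tail; apply: light_ideal; exists 0, (theta G i); rewrite add0r.
split=> //; first exact: ideal0.
exists [:: (1, theta G i)]; rewrite big_seq1 mul1r; split=> // x.
by rewrite inE => /eqP ->; exists i.
Qed.

Lemma lightX i : light (k - lead i).+1 'X_i.
Proof.
rewrite -['X_i](subrK 'X_(lead i)); apply: lightD.
  exact: light_leq (leqnSn _) (light_diff i).
by apply: light_freeX; rewrite ?lead_lt.
Qed.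

Lemma light1 : light 1 1.
Proof.
rewrite -mpolyX0; apply: light_mon => [i _|]; first by rewrite mnm0E.
by rewrite /weight big1 // => i _; rewrite mnm0E.
Qed.

Lemma light_exp c n : (c < k)%N -> light (n * (k - c)).+1 ('X_c ^+ n).
Proof.
move=> ck; elim: n => [|n ih]; first exact: light1.
rewrite exprS mulSn -addSn; apply: lightM ih.
exact: light_freeX.
Qed.

(** The factors are replaced by ['X_c] one at a time; each replacement costs a difference
    ['X_i - 'X_c], strictly lighter than ['X_c]. *)
Lemma light_prod_diff c (s : seq 'I_q) : (c < k)%N ->
  (forall i, i \in s -> lead i = c) ->
  light (size s * (k - c)) (\prod_(i <- s) 'X_i - 'X_c ^+ size s).
Proof.
move=> ck; elim: s => [_|i s ih hs].
  by rewrite big_nil subrr; apply: light_ideal; apply: (ideal0 K).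
have lic : lead i = c by rewrite hs ?mem_head.
rewrite big_cons exprS mulSn.
set P := \prod_(j <- s) _; set Q := 'X_c ^+ _.
have -> : 'X_i * P - 'X_c * Q = (P - Q) * 'X_i + ('X_i - 'X_c) * Q.
  by rewrite mulrC !mulrBl [Q * _]mulrC addrA subrK.
apply: lightD.
  rewrite addnC; apply: lightM; last by rewrite -lic; apply: lightX.
  by apply: ih => j js; rewrite hs // inE js orbT.
by apply: lightM; [rewrite -lic; apply: light_diff|apply: light_exp].
Qed.

(** This is the rewriting rule: the product over [face_body c] is a generator of the ideal and
    differs from the power of ['X_c] by lighter terms. *)
Lemma light_power c : (c < k)%N ->
  light (#|face_body c| * (k - c)) ('X_c ^+ #|face_body c|).
Proof.
move=> ck; have := @light_prod_diff c (enum (face_body c)) ck; rewrite -cardE.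
set P := \prod_(i <- _) _; set Q := 'X_c ^+ _ => H.
(* In characteristic two the right-hand side is [- Q = Q]. *)
have -> : Q = (P - Q) + P.
  rewrite addrAC mpolyF2_addxx add0r; apply/eqP.
  by rewrite -addr_eq0 mpolyF2_addxx.
apply: lightD; first by apply: H => i; rewrite mem_enum inE => /andP[/eqP].
apply: light_ideal; exists P, 0; rewrite addr0; split=> //; last exact: ideal0.
exists [:: (1, P)]; rewrite big_seq1 mul1r; split=> // x.
rewrite inE => /eqP -> /=; exists (face c); first exact: (face_circuit hG).
by rewrite broken_face // /P big_enum.
Qed.

Definition reducible f : Prop :=
  exists f', K (f - f') /\ forall m, m \in msupp f' -> Lmon G m.

Lemma reducibleD f g : reducible f -> reducible g -> reducible (f + g).
Proof.
move=> [f' [Kf fL]] [g' [Kg gL]]; exists (f' + g'); split.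
  by rewrite opprD addrACA; apply: (@idealD _ K).
by move=> m /msuppD_le; rewrite mem_cat => /orP[/fL|/gL].
Qed.

Lemma reducible_ideal f : K f -> reducible f.
Proof. by move=> Kf; exists 0; rewrite subr0; split=> // m; rewrite msupp0. Qed.

Lemma F2_mpolyE f : f = \sum_(m <- msupp f) 'X_[m].
Proof.
rewrite {1}[f]mpolyE !big_seq; apply: eq_bigr => m.
by rewrite mcoeff_msupp => /F2_neq0 ->; rewrite scale1r.
Qed.

(** A monomial outside the box contains a full power ['X_c ^+ #|face_body c|], and [light_power]
    trades it for lighter monomials. *)
Lemma light_reducible w f : light w f -> reducible f.
Proof.
elim: w f => [|w ih] f [f' [Kf fw]]; rewrite -(subrK f' f).
  apply: reducibleD; first exact: reducible_ideal.
  rewrite [f']F2_mpolyE big_seq big1 => [|m /fw[] //].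
  by apply: reducible_ideal; apply: (ideal0 K).
apply: reducibleD; first exact: reducible_ideal.
rewrite [f']F2_mpolyE big_seq; apply: big_ind => [||m /fw[Mm mw]].
- by apply: reducible_ideal; apply: (ideal0 K).
- exact: reducibleD.
have [/forall_inP box|/forall_inPn[c ck]] :=
  boolP [forall c : 'I_q in [pred c : 'I_q | c < k]%N, (m c < #|face_body c|)%N].
  exists 'X_[m]; rewrite subrr; split; first exact: (ideal0 K).
  by move=> m'; rewrite msuppX inE => /eqP ->; apply/LmonE.
rewrite inE in ck; rewrite -leqNgt => hm.
have cm : (U_(c) *+ #|face_body c| <= m)%MM.
  apply/mnm_lepP => i; rewrite mulmnE mnm1E.
  by have [<-|_] := eqVneq c i; rewrite ?mul1n ?mul0n.
apply: ih; rewrite -(submK cm) mpolyXD mulrC -mpolyXn.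
have wE : (weight m = #|face_body c| * (k - c) + weight (m - U_(c) *+ #|face_body c|)%MM)%N.
  by rewrite -{1}(submK cm) weightD weightU addnC.
apply: (@light_leq (weight m)) => //; rewrite wE.
apply: lightM; first exact: light_power.
by apply: light_mon => // i ki; rewrite mnmBE Mm.
Qed.

(** Every variable is light for some bound by [lightX], and sums and products inherit this. *)
Lemma light_bound f : exists w, light w f.
Proof.
have bD g h : (exists w, light w g) -> (exists w, light w h) ->
    exists w, light w (g + h).
  move=> [w lg] [v lh]; exists (w + v)%N.
  by apply: lightD; [apply: light_leq lg|apply: light_leq lh]; lia.
have bM g h : (exists w, light w g) -> (exists w, light w h) ->
    exists w, light w (g * h).
  move=> [w lg] [v lh]; exists (w + v)%N.
  by apply: (lightM lg); apply: light_leq lh.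
have b1 : exists w, light w 1 by exists 1%N; apply: light1.
rewrite [f]F2_mpolyE; apply: (big_ind (fun g => exists w, light w g)) => [|//|m _].
  by exists 0%N; apply: light_ideal; apply: (ideal0 K).
rewrite mpolyXE_id; apply: (big_ind (fun g => exists w, light w g)) => // i _.
elim: (m i) => [//|n ih].
by rewrite exprS; apply: bM => //; exists (k - lead i).+1; apply: lightX.
Qed.

Lemma reducible_all f : reducible f.
Proof. by have [w] := light_bound f; apply: light_reducible. Qed.

(** * The basis property *)

Lemma RG_proj_eq0 f :
  idealq_proj K f = 0 -> (forall m, m \in msupp f -> Lmon G m) -> f = 0.
Proof. by move=> /idealq_proj_eq0; apply: reduced_eq0. Qed.

Theorem nested_cuts_NBC : has_NBC_basis G.
Proof.
have inj m m' : Lmon G m -> Lmon G m' -> RG_monomial G m = RG_monomial G m' -> m = m'.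
  move=> Lm Lm' e; have : 'X_[m] - 'X_[m'] = 0 :> {mpoly 'F_2[q]}.
    apply: RG_proj_eq0; first by rewrite raddfB /=; apply/eqP; rewrite subr_eq0; apply/eqP.
    by move=> x /msuppB_le; rewrite mem_cat !msuppX !inE => /orP[] /eqP ->.
  move=> /(congr1 (mcoeff m)); rewrite mcoeffB !mcoeffX eqxx mcoeff0.
  by case: eqP => // _ /eqP; rewrite subr0 oner_eq0.
split; [exact: standardG | exact: inj |]; split.
  move=> s c us sL.
  (* A list of distinct classes lifts to a list of distinct monomials, so a relation in the quotient
     lifts to a polynomial supported on [Lmon]. *)
  have [ms [msE msL]] : exists ms,
      s = map (RG_monomial G) ms /\ forall m, m \in ms -> Lmon G m.
    elim: s {us} sL => [|v s ih] sL; first by exists [::].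
    have [|ms [-> msL]] := ih; first by move=> u us; apply: sL; rewrite inE us orbT.
    have [m Lm ->] := sL v (mem_head _ _); exists (m :: ms); split=> // m'.
    by rewrite inE => /orP[/eqP ->|/msL].
  subst s; have ums := map_uniq us.
  pose f : {mpoly 'F_2[q]} := \sum_(m <- ms) c (RG_monomial G m) *: 'X_[m].
  have coef m : m \in ms -> f@_m = c (RG_monomial G m).
    move=> mms; rewrite /f raddf_sum /= (bigD1_seq m) //= mcoeffZ mcoeffX eqxx mulr1.
    by rewrite big1 ?addr0 // => m' nm; rewrite mcoeffZ mcoeffX (negPf nm) mulr0.
  move=> sum0 v /mapP[m mms ->]; rewrite -coef //.
  suff -> : f = 0 by rewrite mcoeff0.
  apply: RG_proj_eq0; first rewrite -{}sum0 big_map raddf_sum.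
    by apply: eq_bigr => x _; rewrite /= linearZ.
  move=> x xf; apply: msL; apply: contraTT xf => nx.
  rewrite mcoeff_msupp negbK raddf_sum big_seq big1 //= => m' m'ms.
  rewrite mcoeffZ mcoeffX; case: eqP => [e|_]; last by rewrite mulr0.
  by rewrite e (negPf nx) in m'ms.
(* Over ['F_2] the reduced form of a representative is a plain sum of monomials, so all coefficients
   are 1. *)
move=> w; have [f' [Kf fL]] := reducible_all (repr w).
exists (map (RG_monomial G) (msupp f')), (fun=> 1); split.
  by move=> v /mapP[m /fL Lm ->]; exists m.
have -> : w = idealq_proj K f'.
  by rewrite -{1}[w]reprK; apply/idealq_eqP/idealbP.
rewrite big_map {1}[f']F2_mpolyE raddf_sum; apply: eq_bigr => m _.
by rewrite scale1r.
Qed.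

End NestedCuts.

Local Close Scope ring_scope.

(** * Phi graphs *)

Section PhiGraph.
Variables (V : finType) (q : nat) (G : mgraph V 'I_q) (D : phi_data).
Variables (piV : cycpt D -> V) (piE : cycpt D -> 'I_q).
Hypotheses (hphi : phi_graph G piV piE) (hlab : phi_labeling G piE).
Local Notation k := (nullity V q).
Local Notation t := (ncyc D).
Local Notation T := (tree_edges V q).
Implicit Types (i : 'I_t) (a b : cycpt D) (e : 'I_q).

(** On the last cycle [stop] exceeds every position, so there only position 0 is excluded. *)
Definition is_path a : bool := (0 < tagged a)%N && (tagged a != stop (tag a) :> nat).

Lemma pt_eta a : a = pt (tagged a).
Proof. by case: a. Qed.

Lemma cycpt_eq a b : tag a = tag b -> tagged a = tagged b :> nat -> a = b.
Proof.
case: a b => [i j] [i' j'] /= e; subst i' => /= ejj.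
by congr existT; apply/val_inj.
Qed.

Lemma mem_path_edges a : (a \in path_edges D) = is_path a.
Proof.
apply/flatten_mapP/idP => [[i _]|ha].
  rewrite mem_cat mem_rev => /orP[] /mapP[j]; rewrite mem_filter /is_path.
    by move=> /andP[/andP[j0 js] _] -> /=; rewrite j0 neq_ltn js.
  move=> /andP[js _] -> /=; rewrite neq_ltn js orbT andbT.
  exact: leq_ltn_trans js.
case: a ha => i j; rewrite /is_path neq_ltn /= => /andP[j0 hj].
exists i; first by rewrite mem_enum.
rewrite mem_cat mem_rev; case/orP: hj => hj; apply/orP; [left|right];
  by apply/mapP; exists j => //; rewrite mem_filter ?j0 hj mem_enum.
Qed.

Lemma stop_lt i i' : i' = i.+1 :> nat -> stop i = fpos i.
Proof. by move=> e; rewrite /stop -e ltn_eqF. Qed.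

Lemma glue_edge_piE a b : glue_edge a b -> piE a = piE b.
Proof.
have [_ _ hE _] := hphi => ab; apply/eqP; rewrite hE.
by apply: connect1; rewrite ab.
Qed.

Lemma piE_f i i' : i' = i.+1 :> nat -> piE (edge_f i) = piE (edge_e i').
Proof.
move=> e; apply: glue_edge_piE; apply/existsP; exists i; apply/existsP; exists i'.
by rewrite e !eqxx.
Qed.

Lemma is_path_glue a b : glue_edge a b -> is_path a = is_path b.
Proof.
move=> /existsP[i /existsP[i' /and3P[/eqP e /eqP -> /eqP ->]]].
by rewrite /is_path /= (stop_lt e) eqxx andbF.
Qed.

Lemma is_path_piE a b : piE a = piE b -> is_path a = is_path b.
Proof.
have [_ _ hE _] := hphi => /eqP; rewrite hE => ab.
have cl : closed (fun x y => glue_edge x y || glue_edge y x) is_path.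
  by move=> x y /orP[] /is_path_glue; rewrite !unfold_in.
exact: (closed_connect cl ab).
Qed.

Lemma not_path a : ~~ is_path a ->
  (exists i, a = edge_e i) \/ exists i i', i' = i.+1 :> nat /\ a = edge_f i.
Proof.
rewrite /is_path negb_and lt0n !negbK => /orP[/eqP a0|].
  by left; exists (tag a); apply: cycpt_eq.
rewrite /stop; case: ifP => [_ /eqP as_|+ /eqP af].
  by have := ltn_ord (tagged a); rewrite as_ ltnn.
move=> nlast; have lt : ((tag a).+1 < t)%N by rewrite ltn_neqAle nlast ltn_ord.
by right; exists (tag a), (Ordinal lt); split=> //; apply: cycpt_eq.
Qed.

Lemma edge_cases e :
  (exists i, e = piE (edge_e i)) \/ exists2 a, is_path a & e = piE a.
Proof.
have [[_ sE] _ _ _] := hphi; have [a <-] := sE e.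
have [pa|/not_path[[i ->]|[i [i' [ei ->]]]]] := boolP (is_path a).
- by right; exists a.
- by left; exists i.
by left; exists i'; rewrite (piE_f ei).
Qed.

(** * Names of the edges *)

Lemma piE_e i : (piE (edge_e i) + i.+1 = k)%N.
Proof. by have [+ _] := hlab; apply. Qed.

Lemma piE_path a : is_path a -> (piE a + (index a (path_edges D)).+1 = q)%N.
Proof.
have [_ hp] := hlab; rewrite -mem_path_edges => ap.
by rewrite -{1}(nth_index a ap); apply: hp; rewrite index_mem.
Qed.

Lemma piE_path_inj a b : is_path a -> is_path b -> piE a = piE b -> a = b.
Proof.
move=> pa pb ab; have e : index a (path_edges D) = index b (path_edges D).
  by have := piE_path pa; have := piE_path pb; rewrite ab; lia.
rewrite -mem_path_edges in pa; rewrite -mem_path_edges in pb.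
by rewrite -(nth_index a pa) e nth_index.
Qed.

(** The last cycle gives [t <= k]. Conversely, consider the edge named 0: if it is some [edge_e i],
    then [k = i.+1]. If it is a path edge, the path edges exhaust all [q] names, including that of
    [edge_e i0], which is absurd. *)
Lemma nullity_ncyc : k = t.
Proof.
have t0 := ncyc_gt0 D; pose i0 : 'I_t := Ordinal t0.
have tk : (t <= k)%N.
  have lt : (t.-1 < t)%N by rewrite prednK.
  by rewrite -(piE_e (Ordinal lt)) /= prednK // leq_addl.
apply/eqP; rewrite eqn_leq tk andbT.
have q0 : (0 < q)%N := leq_ltn_trans (leq0n _) (ltn_ord (piE (edge_e i0))).
have [[i e]|[a pa e]] := edge_cases (Ordinal q0).
  by rewrite -(piE_e i) -e /= add0n.
have := piE_path pa; rewrite -e /= add0n => qE.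
have vq := ltn_ord (piE (edge_e i0)).
have [n nE] : exists n, (piE (edge_e i0) + n.+1 = q)%N.
  by exists (q - (piE (edge_e i0)).+1)%N; lia.
have nsz : (n < size (path_edges D))%N.
  have : (index a (path_edges D) < size (path_edges D))%N.
    by rewrite index_mem mem_path_edges.
  lia.
have [_ /(_ a n nsz) hn] := hlab.
have : piE (nth a (path_edges D) n) = piE (edge_e i0).
  by apply: ord_inj; lia.
by move/is_path_piE; rewrite -mem_path_edges mem_nth.
Qed.

(** Since [k = t], every name below [k] is taken by some [edge_e i], and such an edge is never
    identified with a path edge. *)
Lemma piE_path_ge a : is_path a -> (k <= piE a)%N.
Proof.
move=> pa; rewrite leqNgt; apply/negP => lt.
have lt' : (k - (piE a).+1 < t)%N by rewrite -nullity_ncyc; lia.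
have : piE a = piE (edge_e (Ordinal lt')).
  by apply: ord_inj; have /= := piE_e (Ordinal lt'); lia.
by move/is_path_piE; rewrite pa /is_path.
Qed.

Lemma piE_e_lt i : (piE (edge_e i) < k)%N.
Proof. by have := piE_e i; lia. Qed.

Lemma free_edge e : (e < k)%N -> exists i, e = piE (edge_e i).
Proof.
by move=> ek; have [//|[a /piE_path_ge]] := edge_cases e; move=> + ea; rewrite -ea leqNgt ek.
Qed.

Lemma tree_edge e : (k <= e)%N -> exists2 a, is_path a & e = piE a.
Proof.
by move=> ke; have [[i ei]|//] := edge_cases e; have := piE_e_lt i; rewrite -ei ltnNge ke.
Qed.

Definition level_edge e : 'I_q :=
  if [pick a | is_path a && (piE a == e)] is Some a then piE (edge_e (tag a)) else e.

Lemma level_edgeE a : is_path a -> level_edge (piE a) = piE (edge_e (tag a)).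
Proof.
move=> pa; rewrite /level_edge; case: pickP => [b /andP[pb /eqP e]|/(_ a)].
  by rewrite (piE_path_inj pb pa e).
by rewrite pa eqxx.
Qed.

(** * Connectivity through path edges *)

Lemma glue_vertex_piV x y : glue_vertex x y -> piV x = piV y.
Proof.
have [_ hV _ _] := hphi => ab; apply/eqP; rewrite hV.
by apply: connect1; rewrite ab.
Qed.

Lemma piV_f i i' : i' = i.+1 :> nat ->
  exists x y : 'I_(len i').+2, piV (pt (fpos i)) = piV (pt x) /\
    piV (pt (ordS (fpos i))) = piV (pt y).
Proof.
move=> e; exists (if flip i then ordS ord0 else ord0).
exists (if flip i then ord0 else ordS ord0).
by split; apply: glue_vertex_piV; apply/existsP; exists i; apply/existsP; exists i';
  rewrite e eqxx /=; case: (flip i); rewrite !eqxx ?orbT.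
Qed.

Lemma piE_joins a :
  joins G (piE a) (piV (pt (tagged a))) (piV (pt (ordS (tagged a)))).
Proof. by have [_ _ _ h] := hphi; exact: h. Qed.

Lemma adj_sym (A : {set 'I_q}) : ssrbool.symmetric (adj G A).
Proof.
by move=> x y; apply/existsP/existsP => -[e /andP[eA ej]]; exists e;
  rewrite eA /joins orbC.
Qed.

(** Inside cycle [i] one walks without using [edge_e i]; the edge [edge_f i] is replaced by a detour
    through the next cycle, whence the induction on [t - i]. *)
Lemma connect_cycle (A : {set 'I_q}) (n : nat) :
  (forall a, is_path a -> (n <= tag a)%N -> piE a \in A) ->
  forall i (j j' : 'I_(len i).+2), (n <= i)%N ->
    connect (adj G A) (piV (pt j)) (piV (pt j')).
Proof.
move=> hA i; have [d] := ubnP (t - i); elim: d i => // d ih i id j j' ni.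
have csym := sym_connect_sym (adj_sym A).
have step (l : 'I_(len i).+2) : (0 < l)%N ->
    connect (adj G A) (piV (pt l)) (piV (pt (ordS l))).
  move=> l0; have [pl|/not_path] := boolP (is_path (pt l)).
    apply: connect1; apply/existsP; exists (piE (pt l)).
    by rewrite hA // (piE_joins (pt l)).
  case=> [[i1 e]|[i1 [i2 [e12 e]]]].
    have ei := congr1 tag e; rewrite /= in ei; subst i1.
    by move/eqP: e l0; rewrite eq_Tagged /= => /eqP ->.
  have ei := congr1 tag e; rewrite /= in ei; subst i1.
  move/eqP: e; rewrite eq_Tagged /= => /eqP ->.
  have [x [y [-> ->]]] := piV_f e12; apply: ih; have := ltn_ord i2; lia.
(* Walking forward from [l] up to the wrap-around at vertex 0 crosses only edges of nonzero
   position. *)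
have to0 (r : nat) (l : 'I_(len i).+2) : (l + r = (len i).+2)%N ->
    connect (adj G A) (piV (pt l)) (piV (pt (ord0 : 'I_(len i).+2))).
  elim: r l => [|r ihr] l lr; first by have := ltn_ord l; lia.
  have [l0|l0] := posnP l.
    by rewrite (_ : l = ord0) ?connect0 //; apply/val_inj.
  apply: connect_trans (step l l0) _.
  case: r ihr lr => [|r] ihr lr.
    rewrite (_ : ordS l = ord0) ?connect0 //; apply/val_inj => /=.
    by rewrite (_ : l.+1 = (len i).+2) ?modnn; lia.
  by apply: ihr; rewrite /= modn_small; lia.
apply: (connect_trans (to0 ((len i).+2 - j)%N j _)).
  by have := ltn_ord j; lia.
by rewrite csym; apply: (to0 ((len i).+2 - j')%N); have := ltn_ord j'; lia.
Qed.

Lemma connected_tree : connected_by G T.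
Proof.
have [[sV _] _ _ _] := hphi; have t0 := ncyc_gt0 D.
pose x0 : V := piV (edge_e (Ordinal t0)).
split; first by apply/card_gt0P; exists x0.
have csym := sym_connect_sym (adj_sym T).
have con i (j j' : 'I_(len i).+2) : connect (adj G T) (piV (pt j)) (piV (pt j')).
  by apply: (@connect_cycle T 0) => // a pa _; rewrite inE piE_path_ge.
have to0 n : forall i (j : 'I_(len i).+2), i = n :> nat ->
    connect (adj G T) x0 (piV (pt j)).
  elim: n => [|n ih] i j ein.
    have e : i = Ordinal t0 by apply: ord_inj.
    by subst i; apply: con.
  have lt : (n < t)%N by have := ltn_ord i; lia.
  have [x [y [ex _]]] := @piV_f (Ordinal lt) i ein.
  apply: connect_trans (con i x j); rewrite -ex; exact: ih.
move=> x y; have [a <-] := sV x; have [b <-] := sV y.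
rewrite [a]pt_eta [b]pt_eta; apply: connect_trans (to0 _ _ _ (erefl _)).
by rewrite csym; apply: to0.
Qed.

(** * Two-colourings of the vertices *)

Definition fpos_nat (n : nat) : nat := oapp (fun i => fpos i : nat) 0%N (insub n).
Definition flip_nat (n : nat) : bool := oapp (@flip D) false (insub n).

Lemma fpos_natE i : fpos_nat i = fpos i.
Proof. by rewrite /fpos_nat (valK i). Qed.

Lemma flip_natE i : flip_nat i = flip i.
Proof. by rewrite /flip_nat (valK i). Qed.

(* On cycle n, [colour th] separates the vertices 1, ..., th n from the others, so
   the edges 0 and th n cross (none when th n = 0); [parity] exchanges the two
   colours so as to agree with the preceding cycle along the glued edge. *)
Fixpoint parity (th : nat -> nat) (n : nat) : bool :=
  if n is n'.+1 then
    parity th n' (+) (if th n == 0%N then (fpos_nat n' <= th n')%N else ~~ flip_nat n')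
  else false.

Definition colour (th : nat -> nat) a : bool :=
  (0 < tagged a <= th (tag a))%N (+) parity th (tag a).

(** The second condition says that [edge_f i] changes colour exactly when [edge_e i'], glued to it,
    does. *)
Definition compatible (th : nat -> nat) : Prop :=
  (forall i, th i <= (len i).+1)%N /\
  forall i i', i' = i.+1 :> nat -> (th i == fpos i :> nat) = (0 < th i')%N.

Lemma ordSE n (j : 'I_n.+2) : ordS j = (if j == n.+1 :> nat then 0 else j.+1)%N :> nat.
Proof.
rewrite /=; case: eqP => [->|nj]; first by rewrite modnn.
by rewrite modn_small //; have := ltn_ord j; lia.
Qed.

(** If [th i' = 0], cycle [i'] is monochromatic, and so are the ends of [edge_f i]. Otherwise both
    glued edges change colour and [flip] decides which ends match. *)
Lemma colour_glue th x y : compatible th -> glue_vertex x y -> colour th x = colour th y.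
Proof.
move=> [th_le th_f] /existsP[i /existsP[i' /andP[/eqP e]]].
have f0 : (0 < fpos i)%N by rewrite lt0n; apply: fpos_neq0.
have := th_f i i' e; have := th_le i.
have pE : parity th i' = parity th i (+)
    (if th i' == 0%N then (fpos i <= th i)%N else ~~ flip i).
  by rewrite e /= fpos_natE flip_natE.
have fS := ordSE (fpos i); have fl := ltn_ord (fpos i).
rewrite /colour /disjoint_cycles /=.
case: ifP => flipi tl tf /orP[] /andP[/eqP -> /eqP ->]; rewrite /= pE flipi
  ?[(1 %% _)%N]modn_small // -?[((fpos i).+1 %% _)%N]/(ordS (fpos i) : nat) ?fS;
  move: f0 fl tl tf; case: (eqVneq (th i') 0%N) => [->|ti'];
  case: (eqVneq (fpos i : nat) (len i).+1) => fi;
  case: parity; lia.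
Qed.

Lemma colour_quotient th : compatible th ->
  exists chi : V -> bool, forall a, chi (piV a) = colour th a.
Proof.
move=> hth; exists (fun x => [exists a, (piV a == x) && colour th a]) => a.
apply/existsP/idP => [[b /andP[/eqP ba cb]]|ca]; last by exists a; rewrite eqxx.
have [_ hV _ _] := hphi; move/eqP: ba; rewrite hV => ba.
have cl : closed (fun x y => glue_vertex x y || glue_vertex y x) (colour th).
  by move=> x y /orP[] /(colour_glue hth); rewrite !unfold_in.
by have <- : colour th b = colour th a := closed_connect cl ba.
Qed.

Lemma cross_threshold (x y n : nat) (b : bool) : (x < n.+2)%N -> (y <= n.+1)%N ->
  (0 < x <= y)%N (+) b (+)
    ((0 < (if x == n.+1 then 0 else x.+1) <= y)%N (+) b) =
  (0 < y)%N && ((x == 0%N) || (x == y)).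
Proof. by case: (eqVneq x n.+1); case: b; lia. Qed.

Lemma colour_cross th chi a : compatible th ->
    (forall b, chi (piV b) = colour th b) ->
  chi (G (piE a)).1 (+) chi (G (piE a)).2 =
    (0 < th (tag a))%N &&
      ((tagged a == 0%N :> nat) || (tagged a == th (tag a) :> nat)).
Proof.
move=> [th_le _] hchi.
have -> : chi (G (piE a)).1 (+) chi (G (piE a)).2 =
    chi (piV (pt (tagged a))) (+) chi (piV (pt (ordS (tagged a)))).
  by case/orP: (piE_joins a) => /eqP -> /=; rewrite // addbC.
rewrite !hchi /colour; have := th_le (tag a); have := ordSE (tagged a).
rewrite [tag (pt _)]/= [tag (pt _)]/= [tagged (pt _)]/= [tagged (pt _)]/= => ->.
by move=> ylen; apply: cross_threshold => //; apply: ltn_ord.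
Qed.

(** The cut crosses each cycle before [i] from e to f and leaves cycle [i] at position [p]: it is
    the cutset of the tree edge at [p]. *)
Definition threshold i (p n : nat) : nat :=
  if (n < i)%N then fpos_nat n else if n == i then p else 0%N.

Lemma threshold_compatible i (p : 'I_(len i).+2) :
  is_path (pt p) -> compatible (threshold i p).
Proof.
move=> /andP[/= p0 ps]; split=> [l|l l' ll'].
  rewrite /threshold; case: ltnP => _; first by rewrite fpos_natE -ltnS.
  by case: eqP => // /ord_inj ->; rewrite -ltnS.
rewrite /threshold fpos_natE ll'.
have f0 (x : 'I_t) : (0 < fpos x)%N by rewrite lt0n; apply: fpos_neq0.
have [li|li|/ord_inj li] := ltngtP l i.
- rewrite eqxx -ll'; move: li; rewrite -ll' leq_eqVlt => /orP[/eqP ->|li].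
    by rewrite ltnn eqxx.
  by rewrite li fpos_natE f0.
- have := f0 l; rewrite ltn_neqAle => /andP[/negPf -> _].
  by have [-> ->] : (l.+1 < i)%N = false /\ (l.+1 == i) = false by split; lia.
(* As a path position, [p] differs from that of [edge_f i], so the cut does not enter the next
   cycle. *)
subst l; rewrite -(stop_lt ll') (negPf ps).
by have [-> ->] : (i.+1 < i)%N = false /\ (i.+1 == i) = false by split; lia.
Qed.

Lemma fpos_nat_compatible : compatible fpos_nat.
Proof.
split=> [l|l l' _]; rewrite !fpos_natE ?eqxx; first by rewrite -ltnS.
by rewrite lt0n; apply/esym/fpos_neq0.
Qed.

(** Gluing does not merge vertices of one cycle, because some colouring of the quotient separates
    them. *)
Lemma piV_inj i (j j' : 'I_(len i).+2) : piV (pt j) = piV (pt j') -> j = j'.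
Proof.
wlog lt : j j' / (j < j')%N.
  move=> H e; have [jj|jj|/ord_inj //] := ltngtP j j'; first exact: H.
  by apply/esym; apply: H.
(* A threshold [p] colours exactly 1, ..., [p]: it separates [j > 0] from the later [j'] when
   [p = j], and 0 from [j'] when [p = j']. *)
pose p := if j == 0%N :> nat then j' else j.
have [th hth thi] : exists2 th, compatible th & th i = p.
  have [pp|np] := boolP (is_path (pt p)).
    exists (threshold i p); first exact: threshold_compatible.
    by rewrite /threshold ltnn eqxx.
  (* Here [p] is the position of f, so the cut must continue into the following cycles. *)
  exists fpos_nat; first exact: fpos_nat_compatible.
  rewrite fpos_natE; have p0 : (0 < p)%N by rewrite /p; case: eqP lt; lia.
  case: (not_path np) => [[i1 e]|[i1 [i2 [_ e]]]];
    have ei := congr1 tag e; rewrite /= in ei; subst i1;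
    move/eqP: e; rewrite eq_Tagged /= => /eqP e; rewrite e // in p0 *.
have [chi hchi] := colour_quotient hth => e.
have := hchi (pt j); rewrite e hchi /colour /= thi => /addIb.
by rewrite /p; case: eqP lt; lia.
Qed.

(** * The cycles as circuits of the phi graph *)

Lemma val_piE a : ~~ is_path a ->
  (piE a + (if tagged a == 0%N :> nat then (tag a).+1 else (tag a).+2) = k)%N.
Proof.
move=> /not_path[[i ->]|[i [i' [ii ->]]]]; first exact: piE_e.
have /negPf f0 : fpos i != 0%N :> nat := fpos_neq0 i.
by rewrite [tagged _]/= f0 (piE_f ii) -(piE_e i') ii.
Qed.

Lemma piE_cycle_inj i (j j' : 'I_(len i).+2) : piE (pt j) = piE (pt j') -> j = j'.
Proof.
move=> e; have := is_path_piE e.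
have [pj /esym pj'|nj /esym/negbT nj'] := boolP (is_path (pt j)).
  by have /eqP := piE_path_inj pj pj' e; rewrite eq_Tagged /= => /eqP.
have := val_piE nj; have := val_piE nj'; rewrite e /= => {}e e'.
move: nj nj'; rewrite /is_path /= !negb_and !lt0n !negbK.
move: e; rewrite -{}e' => /addnI.
case: eqP => [j'0|nj'0]; case: eqP => [j0|nj0] /=; try lia.
  by move=> _ _ _; apply: ord_inj; rewrite j0 j'0.
by move=> _ /eqP js /eqP js'; apply: ord_inj; rewrite js js'.
Qed.

Lemma image_cycle i :
  [set piE (pt j) | j in [set: 'I_(len i).+2]] =
  face V level_edge (piE (edge_e i)).
Proof.
apply/setP => e; apply/imsetP/idP => [[j _ ->]|].
  rewrite inE; have [pj|nj] := boolP (is_path (pt j)).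
    by rewrite leadT ?piE_path_ge // level_edgeE // eqxx.
  have := val_piE nj; have := piE_e i; have := piE_e_lt i.
  case: eqP => /= [j0|_] ik ei ej.
    by rewrite (_ : pt j = edge_e i) ?lead_id ?eqxx //; apply: cycpt_eq.
  by apply/orP; right; lia.
rewrite inE => /orP[/eqP|/eqP].
  have [ek|ke] := ltnP e k.
    by rewrite lead_id // => ->; exists ord0.
  rewrite leadT //; have [a pa ->] := tree_edge ke.
  rewrite level_edgeE // => /(congr1 val) /= eq.
  have ei : tag a = i.
    by apply: ord_inj; have := piE_e i; have := piE_e (tag a); rewrite eq; lia.
  by subst i; exists (tagged a); rewrite ?inE // -pt_eta.
(* The name 0 belongs to the last cycle, where [c.-1 = c]; otherwise [c.-1] names [edge_e] of the
   next cycle, glued to [edge_f i]. *)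
move=> ee; have [e0|e0] := posnP (piE (edge_e i)).
  by exists ord0 => //; apply: ord_inj; rewrite ee -/(edge_e i) e0.
have lt : (i.+1 < t)%N by have := nullity_ncyc; have := piE_e i; lia.
exists (fpos i) => //; rewrite -/(edge_f i) (@piE_f i (Ordinal lt)) //.
by apply: ord_inj; have := piE_e (Ordinal lt); have := piE_e i; rewrite /=; lia.
Qed.

Lemma piE_e_le i i' : (piE (edge_e i) <= piE (edge_e i'))%N = (i' <= i)%N.
Proof. by have := piE_e i; have := piE_e i'; lia. Qed.

Lemma phi_nested_cuts : nested_cuts G level_edge.
Proof.
split.
- by move=> e /tree_edge[a pa ->]; rewrite level_edgeE // piE_e_lt.
- exact: connected_tree.
- move=> e /tree_edge[a pa ->]; rewrite level_edgeE //.
  have hth : compatible (threshold (tag a) (tagged a)).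
    by apply: threshold_compatible; rewrite -pt_eta.
  have [chi hchi] := colour_quotient hth; exists chi => e'.
  have [[i ->]|[b pb ->]] := edge_cases e'.
    rewrite (colour_cross _ hth hchi) /= andbT /threshold piE_e_lt andbT.
    have -> : (piE (edge_e i) == piE a) = false.
      by apply/eqP => /is_path_piE; rewrite pa /is_path.
    have p0 : (0 < tagged a)%N by case/andP: pa.
    have f0 : (0 < fpos i)%N by rewrite lt0n; apply: fpos_neq0.
    rewrite /= piE_e_le; case: (ltngtP i (tag a)) => // ia.
    by rewrite fpos_natE.
  rewrite (colour_cross _ hth hchi) [(piE b < k)%N]ltnNge piE_path_ge // andbF orbF.
  case/andP: (pb) => b0 bs; rewrite [tagged b == 0%N :> nat]gtn_eqF //=.
  have -> : (piE b == piE a) = (b == a).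
    by apply/eqP/eqP => [/(piE_path_inj pb pa)|-> //].
  rewrite /threshold; case: (ltngtP (tag b) (tag a)) => ba.
  (* In an earlier cycle the cut crosses only e and f, and the path edge [b] is neither. *)
  - have lt : ((tag b).+1 < t)%N := leq_ltn_trans ba (ltn_ord _).
    rewrite fpos_natE -(@stop_lt (tag b) (Ordinal lt)) // (negPf bs) andbF.
    by apply/esym/eqP => eba; rewrite eba ltnn in ba.
  - by apply/esym/eqP => eba; rewrite eba ltnn in ba.
  have [->|nab] := eqVneq b a; first by rewrite eqxx andbT; case/andP: pa.
  by apply/negP => /andP[_ /eqP eab]; case/eqP: nab; apply: cycpt_eq => //; apply: ord_inj.
- move=> e e' /tree_edge[a pa ->]; rewrite level_edgeE // => lt.
  have [i ei] := free_edge (ltn_trans lt (piE_e_lt _)).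
  have ai : (tag a < i)%N by have := piE_e i; have := piE_e (tag a); rewrite -ei; lia.
  have con : connect (adj G (T :\ piE a)) (piV (pt (ord0 : 'I_(len i).+2)))
      (piV (pt (ordS (ord0 : 'I_(len i).+2)))).
    (* Names below that of [edge_e (tag a)] belong to later cycles, whose path edges avoid [a]. *)
    apply: (@connect_cycle _ i) => // b pb ib; rewrite !inE piE_path_ge // andbT.
    by apply/eqP => /(piE_path_inj pb pa) ba; rewrite ba leqNgt ai in ib.
  rewrite ei; case/orP: (piE_joins (edge_e i)) => /eqP -> //=.
  by rewrite (sym_connect_sym (adj_sym _)).
- have lt : (t.-1 < t)%N by rewrite prednK // ncyc_gt0.
  pose i : 'I_t := Ordinal lt.
  have l1 : (1 < (len i).+2)%N by [].
  (* The last cycle has length at least two and no f, so position 1 holds a path edge. *)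
  have p1 : is_path (pt (Ordinal l1)).
    by rewrite /is_path /= /stop /= prednK ?ncyc_gt0 // eqxx.
  exists (piE (pt (Ordinal l1))); first exact: piE_path_ge.
  rewrite level_edgeE //; have := piE_e i; rewrite nullity_ncyc /=; have := ncyc_gt0 D; lia.
move=> c /free_edge[i ->]; exists (len i).+2, (fun j => piV (pt j)), (fun j => piE (pt j)).
split=> //.
- by move=> j j'; apply: piV_inj.
- by move=> j j'; apply: piE_cycle_inj.
- by move=> j; apply: (piE_joins (pt j)).
by rewrite image_cycle.
Qed.

End PhiGraph.

Theorem theorem4p4 (V : finType) (q : nat) (G : mgraph V 'I_q)
    (D : phi_data) (piV : cycpt D -> V) (piE : cycpt D -> 'I_q)
    (hphi : phi_graph G piV piE) (hlab : phi_labeling G piE) :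
  has_NBC_basis G.
Proof. exact: nested_cuts_NBC (phi_nested_cuts hphi hlab). Qed.
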